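(* Let $\nu>3/2$, $t>0$ and $n\in\mathbb{N}$. Then for all $x>0$ the following Rodrigues-type formula holds: $$ P^\nu_n(x,t) = x^{-\nu} e^{x+t/x} \frac{d^{n}}{dx^{n} } \left[ e^{-x} x^{\nu+n} \sum_{k=0}^\infty \frac{d_{n,k+n}^\nu(t)\ k! }{ (k+n)!} \ L_k^{n+\nu} (x)\right].$$
   Context: $\mathbb{N}=\{1,2,\dots\}$, $\mathbb{N}_0=\{0,1,2,\dots\}$. For $\nu\in\mathbb{R}$, $t>0$, $\{P_n^\nu(x,t)\}_{n\ge 0}$ is the sequence of polynomials in $x$ with $P_n^\nu$ of degree exactly $n$ and $\int_0^\infty P_n^\nu(x,t)P_m^\nu(x,t)e^{-x-t/x}x^\nu dx=\delta_{n,m}$ for $n,m\in\mathbb{N}_0$; the sign is fixed so that the leading coefficient has sign $(-1)^n$. $L_k^\alpha(x)=\frac{x^{-\alpha}e^x}{k!}\frac{d^k}{dx^k}\left[x^{k+\alpha}e^{-x}\right]$ are the classical Laguerre polynomials. For $n,k\in\mathbb{N}_0$ the numbers $d_{n,k}^\nu(t)$ are the Laguerre coefficients of $e^{-t/x}P_n^\nu(x,t)$: $$ d_{n,k}^\nu(t) = \frac{k!}{\Gamma(k+\nu+1)} \int_0^\infty e^{-x -t/x} P^\nu_n(x,t) L_k^\nu(x) x^\nu dx.$$ *)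

(* Defs.v *)
From HB Require Import structures.
From mathcomp Require Import all_boot all_order all_algebra.
From mathcomp Require Import all_classical all_reals all_analysis.

Set Implicit Arguments.
Unset Strict Implicit.
Unset Printing Implicit Defensive.

Import Order.TTheory GRing.Theory Num.Theory.
Import numFieldNormedType.Exports.

Local Open Scope ring_scope.
Local Open Scope classical_set_scope.

Section Defs.
Context {R : realType}.
Implicit Types (a nu t s x : R) (k n : nat).

Let mu : set R -> \bar R := @lebesgue_measure R.

(* Euler's integral; only meaningful for 0 < s. *)
Definition Gamma s : R :=
  \int[mu]_(x in `]0, +oo[) (x `^ (s - 1) * expR (- x)).

(* Rodrigues' formula; only meaningful for 0 < x. *)
Definition laguerre k a x : R :=
  x `^ (- a) * expR x / k`!%:R *
  derive1n k (fun y : R => y `^ (k%:R + a) * expR (- y)) x.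

(* Orthonormality is stated with the extended-real integral, so that a finite
   value forces the integrand to be integrable. *)
Definition orthonormal_polys nu t (P : nat -> {poly R}) : Prop :=
  [/\ forall n, size (P n) = n.+1,
      forall n, Num.sg (lead_coef (P n)) = (-1) ^+ n
    & forall n m,
        (\int[mu]_(x in `]0%R, +oo[)
           ((P n).[x] * (P m).[x] * expR (- x - t / x) * x `^ nu)%:E
         = ((n == m)%:R)%:E)%E].

(* Laguerre coefficient of index k of x |-> expR (- t / x) * p.[x]; for
   p = P n this is d_{n,k}^nu(t). *)
Definition laguerre_coef nu t (p : {poly R}) k : R :=
  k`!%:R / Gamma (k%:R + nu + 1) *
  \int[mu]_(x in `]0, +oo[)
    (expR (- x - t / x) * p.[x] * laguerre k nu x * x `^ nu).

End Defs.

(* Main.v *)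
Require Import Defs.
From HB Require Import structures.
From mathcomp Require Import all_boot all_order all_algebra.
From mathcomp Require Import all_classical all_reals all_analysis.
From mathcomp Require Import measurable_realfun.
From mathcomp Require Import ring lra.
Import Order.TTheory GRing.Theory Num.Theory.
Import numFieldNormedType.Exports.
Local Open Scope ring_scope.
Local Open Scope classical_set_scope.

(** Write w_a(x) = x^a e^-x, f(x) = e^{-t/x} P_n(x), and let d_k be the Laguerre
coefficients of f with parameter nu.

Formally, f = sum_k d_k L_k^nu.  The function w_nu f is P_n times the weight for
which the P_j are orthonormal, so it is orthogonal to all polynomials of degree
below n and d_k = 0 for k < n (lcoef_orthonormal).  Rodrigues' formula gives
(w_{b+1} L_k^{b+1})' = (k+1) w_b L_{k+1}^b (is_derive_lagf); iterating it n times,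
the n-th derivative of w_{nu+n} L_k^{nu+n} is (k+n)!/k! w_nu L_{k+n}^nu.  Hence the
bracket in the theorem is an n-fold primitive of w_nu f, which is the claim.

Convergence is handled by integrating instead of differentiating.  As n >= 1, it is
enough to identify the first primitive,
int_0^x w_nu f = sum_k d_k int_0^x w_nu L_k^nu (laguerre_expansion_integral), and then
to integrate term by term n - 1 more times (rodrigues_sum_primitive).  Every integrand
that occurs is then known to be continuous from the previous step, so the
fundamental theorem of calculus differentiates the sums back.  Three facts
carry this.

- Decay of the coefficients (lcoef_decay): f and all its derivatives are flat at 0 and
  grow slowly at infinity, so integrating by parts m times against w_nu L_k^nu gains a
  factor k^{-m/2}; thus d_k decays faster than any power of k.

- Bound on the Laguerre functions (lagf_bound): w_{b+1} L_k^{b+1} is a primitive of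
  (k+1) w_b L_{k+1}^b, and the L^1 norm of L_{k+1}^b for the weight w_b is controlled by
  its L^2 norm, which is known exactly.  Keeping a factor e^{x/4} inside the integral gives
  |w_{b+1} L_k^{b+1}| <= C (k+1)^A e^{-x/4} on the half-line.  All the series are
  therefore dominated by a multiple of e^{-x/4}, which is integrable.

- Completeness (moment_determinacy): rho = w_nu f - sum_k d_k w_nu L_k^nu is O(e^{-x/4})
  and is orthogonal to every polynomial.  Expanding e^{-cx} in its Taylor series for
  small c, and repeating, rho is orthogonal to e^{-sx} for all s >= 0.  With
  b = ln 2 / x, the functions (1 - e^{-mby})^{2^m} of y are combinations of such
  exponentials, lie between 0 and 1, and converge for y <> x to the indicator of
  y > x, so that int_0^x rho = 0. *)

Set Implicit Arguments.
Unset Strict Implicit.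
Unset Printing Implicit Defensive.

(** * Exponential bounds on the half-line *)

Section ExponentialBounds.
Context {R : realType}.
Implicit Types (c x a : R) (phi psi : R -> R).

(** The rate c is explicit so that rates add up under products; it is positive for
slowly growing factors and negative for decaying ones. *)
Definition expbnd c phi := exists C, forall x, 0 < x -> `|phi x| <= C * expR (c * x).

Lemma expbnd_ge0 c phi : expbnd c phi ->
  exists2 C, 0 < C & forall x, 0 < x -> `|phi x| <= C * expR (c * x).
Proof.
move=> [C hC]; exists (`|C| + 1); first by rewrite ltr_wpDl.
move=> x x0; apply: le_trans (hC _ x0) _; rewrite ler_pM2r ?expR_gt0//.
by rewrite (le_trans (ler_norm _))// lerDl.
Qed.

Lemma eq_expbnd c phi psi : (forall x, 0 < x -> phi x = psi x) ->
  expbnd c phi -> expbnd c psi.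
Proof. by move=> e [C hC]; exists C => x x0; rewrite -e// hC. Qed.

Lemma expbndW c d phi : c <= d -> expbnd c phi -> expbnd d phi.
Proof.
move=> cd /expbnd_ge0[C C0 hC]; exists C => x x0.
by apply: le_trans (hC _ x0) _; rewrite ler_pM2l// ler_expR ler_pM2r.
Qed.

Lemma expbndM c d phi psi : expbnd c phi -> expbnd d psi ->
  expbnd (c + d) (fun x => phi x * psi x).
Proof.
move=> /expbnd_ge0[C C0 hC] [C' hC']; exists (C * C') => x x0.
rewrite normrM mulrDl expRD mulrACA; apply: ler_pM => //; [exact: hC|exact: hC'].
Qed.

Lemma expbndD c phi psi : expbnd c phi -> expbnd c psi ->
  expbnd c (fun x => phi x + psi x).
Proof.
move=> [C hC] [C' hC']; exists (C + C') => x x0.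
by rewrite mulrDl (le_trans (ler_normD _ _))// lerD ?hC ?hC'.
Qed.

Lemma expbndZ c k phi : expbnd c phi -> expbnd c (fun x => k * phi x).
Proof.
move=> [C hC]; exists (`|k| * C) => x x0.
by rewrite normrM -mulrA ler_wpM2l// hC.
Qed.

Lemma expbnd_norm c phi : expbnd c phi -> expbnd c (fun x => `|phi x|).
Proof. by move=> [C hC]; exists C => x x0; rewrite normr_id hC. Qed.

Lemma expbnd_expR c : expbnd c (fun x => expR (c * x)).
Proof. by exists 1 => x x0; rewrite mul1r ger0_norm// expR_ge0. Qed.

Lemma expbnd_cst c k : 0 <= c -> expbnd c (fun=> k).
Proof.
move=> c0; exists `|k| => x x0; rewrite ler_peMr//.
by rewrite -[leLHS]expR0 ler_expR mulr_ge0// ltW.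
Qed.

(** A single term of the exponential series is at most its sum. *)
Lemma exprn_le_expR n x : 0 <= x -> x ^+ n <= n`!%:R * expR x.
Proof.
case: n => [|n] x0.
  by rewrite expr0 fact0 mul1r (le_trans _ (expR_ge1Dx x))// lerDl.
rewrite mulrC -ler_pdivrMr ?ltr0n ?fact_gt0//.
by rewrite (le_trans _ (expR_ge1Dxn n x0))// lerDr.
Qed.

Lemma expbndX c n : 0 < c -> expbnd c (fun x => x ^+ n).
Proof.
move=> c0; exists (n`!%:R / c ^+ n) => x x0.
have cn : 0 < c ^+ n by rewrite exprn_gt0.
rewrite ger0_norm ?exprn_ge0 ?(ltW x0)// mulrAC ler_pdivlMr// -exprMn mulrC.
by rewrite exprn_le_expR// mulr_ge0// ltW.
Qed.

Lemma expbnd_poly c (p : {poly R}) : 0 < c -> expbnd c (fun x => p.[x]).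
Proof.
move=> c0; rewrite (_ : (fun _ => _) = fun x => \sum_(i < size p) p`_i * x ^+ i).
  elim: (size p) => [|n ih].
    by apply: eq_expbnd (expbnd_cst 0 (ltW c0)) => x _; rewrite big_ord0.
  apply: (@eq_expbnd _ (fun x => \sum_(i < n) p`_i * x ^+ i + p`_n * x ^+ n)).
    by move=> x _; rewrite big_ord_recr.
  by apply: expbndD => //; apply/expbndZ/expbndX.
by apply/funext => x; rewrite horner_coef.
Qed.

(** Near 0 the power is at most 1, and for x >= 1 it is at most an integer power. *)
Lemma expbnd_powR c a : 0 < c -> 0 <= a -> expbnd c (fun x => x `^ a).
Proof.
move=> c0 a0; have [A aA] : exists A : nat, a <= A%:R.
  by exists (Num.truncn a).+1; rewrite ltW// truncnS_gt.
have [C hC] : expbnd c (fun x => x ^+ A + 1).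
  by apply: expbndD; [exact: expbndX|exact: expbnd_cst (ltW c0)].
exists C => x x0; apply: le_trans (hC x x0).
rewrite !ger0_norm ?powR_ge0 ?addr_ge0 ?exprn_ge0 ?(ltW x0)//.
have [x1|/ltW x1] := leP 1 x.
  by rewrite (le_trans (ler_powR x1 aA))// powR_mulrn ?(ltW x0)// lerDl.
rewrite (@le_trans _ _ 1) ?lerDr ?exprn_ge0 ?(ltW x0)//.
by rewrite -(powRr0 x) ger_powR// x0.
Qed.

End ExponentialBounds.

(** * Integration of exponentially decaying functions *)

Section ExponentialDecay.
Context {R : realType}.
Implicit Types (c x y e a : R) (phi psi G g : R -> R).

Local Notation mu := (@lebesgue_measure R).
Local Notation Rpos := (`]0, +oo[%classic : set R).

Definition expdecay phi :=
  measurable_fun Rpos phi /\ exists2 c, 0 < c & expbnd (- c) phi.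

Lemma Rpos_continuous_measurable phi :
  (forall x, 0 < x -> {for x, continuous phi}) -> measurable_fun Rpos phi.
Proof.
move=> cphi; apply: open_continuous_measurable_fun.
  exact: interval_open.
by move=> x; rewrite inE/= in_itv/= andbT => /cphi.
Qed.

Lemma is_derive_continuous phi x d : is_derive x 1 phi d -> {for x, continuous phi}.
Proof.
by move=> dphi; apply/differentiable_continuous/derivable1_diffP; apply: ex_derive.
Qed.

Lemma is_derive_expRM c x :
  is_derive x 1 (fun y => expR (c * y)) (c * expR (c * x)).
Proof.
have h : is_derive x 1 (fun y => c * y) (c * 1) by exact: is_deriveZ.
have := @is_derive1_comp _ expR _ x _ _ (is_derive_expR (c * x)) h.
by rewrite mulr1 mulrC.
Qed.

Lemma ge0_integral_expR_tail c x : 0 < c ->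
  (\int[mu]_(y in `]x, +oo[) (expR (- c * y))%:E = (expR (- c * x) / c)%:E)%E.
Proof.
move=> c0; rewrite integral_itv_obnd_cbnd; last first.
  apply/measurable_EFinP/measurableT_comp => //; exact: mulrl_measurable.
rewrite (@ge0_continuous_FTC2y _ _ (fun y => - c^-1 * expR (- c * y)) _ 0).
- by rewrite -EFinB; congr EFin; rewrite sub0r mulNr opprK mulrC.
- by move=> y _; exact: expR_ge0.
- apply: continuous_subspaceT => y.
  exact: (is_derive_continuous (is_derive_expRM _ _)).
- rewrite -[X in _ --> X](mulr0 (- c^-1)); apply: cvgMr.
  rewrite (_ : (fun _ => _) = (fun y => expR (- y)) \o (fun y => y * c)).
    apply: (cvg_comp (fun y => y * c)) (@cvgr_expR R).
    exact: (gt0_cvgMly c0).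
  by apply/funext => y /=; rewrite mulNr mulrC.
- by move=> y _; apply: derivableM => //; have [] := is_derive_expRM (- c) y.
- apply: cvg_at_right_filter; apply: cvgMr.
  exact: (is_derive_continuous (is_derive_expRM _ _)).
- move=> y _; rewrite derive1E.
  have := @is_deriveZ _ _ _ _ (- c^-1) _ _ _ (is_derive_expRM (- c) y).
  move=> /(@derive_val _ _ _ _ _) ->.
  by rewrite /GRing.scale/= mulrA mulrNN mulVf ?mul1r// gt_eqF.
Qed.

Lemma integrable_expR_tail c x : 0 < c ->
  mu.-integrable `]x, +oo[ (fun y => (expR (- c * y))%:E).
Proof.
move=> c0; apply/integrableP; split.
  apply/measurable_EFinP/measurableT_comp => //; exact: mulrl_measurable.
under eq_integral => y _ do rewrite /= ger0_norm ?expR_ge0//.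
by rewrite ge0_integral_expR_tail// ltry.
Qed.

Lemma integrable_CexpR_tail c C x : 0 < c ->
  mu.-integrable `]x, +oo[ (EFin \o (fun y => C * expR (- c * y))).
Proof.
move=> c0.
have -> : EFin \o (fun y => C * expR (- c * y)) =
  (fun y => C%:E * (expR (- c * y))%:E)%E by apply/funext.
by apply: integrableZl => //; exact: integrable_expR_tail.
Qed.

Lemma Rpos_expbnd_integrable c phi : 0 < c -> measurable_fun Rpos phi ->
  expbnd (- c) phi -> mu.-integrable Rpos (EFin \o phi).
Proof.
move=> c0 mphi [C hC].
apply: (@le_integrable _ _ _ mu _ _ _ (fun y => C%:E * (expR (- c * y))%:E)%E) => //.
- exact/measurable_EFinP.
- move=> y /=; rewrite in_itv/= andbT => y0.
  by rewrite lee_fin (le_trans (hC _ y0))// ler_norm.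
- by apply: integrableZl => //; exact: integrable_expR_tail.
Qed.

Lemma expdecay_integrable phi : expdecay phi -> mu.-integrable Rpos (EFin \o phi).
Proof. by move=> [mphi [c c0 bphi]]; exact: Rpos_expbnd_integrable bphi. Qed.

Lemma expdecay_integrableS E phi : measurable E -> E `<=` Rpos -> expdecay phi ->
  mu.-integrable E (EFin \o phi).
Proof.
move=> mE sE /expdecay_integrable; apply: integrableS => //.
Qed.

Lemma expdecayD phi psi : expdecay phi -> expdecay psi -> expdecay (fun x => phi x + psi x).
Proof.
move=> [mphi [c c0 bphi]] [mpsi [d d0 bpsi]]; split.
  exact: measurable_funD.
exists (Num.min c d); first by rewrite lt_min c0.
by apply: expbndD; [apply: expbndW bphi|apply: expbndW bpsi];
  rewrite lerN2 ge_min lexx ?orbT.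
Qed.

Lemma expdecayZ k phi : expdecay phi -> expdecay (fun x => k * phi x).
Proof.
move=> [mphi [c c0 bphi]]; split; first exact: measurable_funM.
by exists c => //; exact: expbndZ.
Qed.

Lemma expdecay_norm phi : expdecay phi -> expdecay (fun x => `|phi x|).
Proof.
move=> [mphi [c c0 bphi]]; split; first exact: measurableT_comp.
by exists c => //; exact: expbnd_norm.
Qed.

Lemma eq_expdecay phi psi : (forall x, 0 < x -> phi x = psi x) -> expdecay phi -> expdecay psi.
Proof.
move=> e [mphi [c c0 bphi]]; split; last by exists c => //; exact: eq_expbnd bphi.
apply: eq_measurable_fun mphi => x; rewrite inE/= in_itv/= andbT; exact: e.
Qed.

Lemma expdecay_continuous c phi : 0 < c -> (forall x, 0 < x -> {for x, continuous phi}) ->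
  expbnd (- c) phi -> expdecay phi.
Proof. by move=> c0 /Rpos_continuous_measurable mphi bphi; split => //; exists c. Qed.

(** The decay of the first factor absorbs the growth of the second one. *)
Lemma expdecayM c d phi psi : c + d < 0 -> measurable_fun Rpos phi ->
  measurable_fun Rpos psi -> expbnd c phi -> expbnd d psi ->
  expdecay (fun x => phi x * psi x).
Proof.
move=> cd mphi mpsi bphi bpsi; split; first exact: measurable_funM.
by exists (- (c + d)); [rewrite oppr_gt0|rewrite opprK; exact: expbndM].
Qed.

Local Notation "'\Int' phi" := (\int[mu]_(x in Rpos) phi x) (at level 10).

Lemma sub_itv_oc_Rpos x : `]0, x] `<=` Rpos.
Proof. by move=> y /=; rewrite !in_itv/= andbT => /andP[]. Qed.

Lemma sub_itv_oo_Rpos x : 0 <= x -> `]x, +oo[ `<=` Rpos.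
Proof.
by move=> x0 y /=; rewrite !in_itv/= !andbT; exact: le_lt_trans.
Qed.

Lemma Rpos_split phi x : 0 < x -> expdecay phi ->
  \Int phi = \int[mu]_(y in `]0, x]) phi y + \int[mu]_(y in `]x, +oo[) phi y.
Proof.
move=> x0 /expdecay_integrable iphi.
have := @Rintegral_itvB R phi (BRight 0) +oo%O x iphi.
by rewrite !bnd_simp ltW// => /(_ isT isT) <-; rewrite addrC subrK.
Qed.

(** Together with the next bound, this shows that neither end of the half-line
contributes to an integral in the limit. *)
Lemma Rintegral_tail_le c C phi x : 0 < c -> 0 < x -> expdecay phi ->
  (forall y, 0 < y -> `|phi y| <= C * expR (- c * y)) ->
  `|\int[mu]_(y in `]x, +oo[) phi y| <= C * (expR (- c * x) / c).
Proof.
move=> c0 x0 ephi hC.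
have iphi := expdecay_integrableS (measurable_itv _) (sub_itv_oo_Rpos (ltW x0)) ephi.
apply: le_trans (le_normr_Rintegral _ iphi) _ => //.
apply: (@le_trans _ _ (\int[mu]_(y in `]x, +oo[) (C * expR (- c * y)))).
  apply: le_Rintegral => //.
  - exact: integrable_norm.
  - exact: integrable_CexpR_tail.
  - move=> y /=; rewrite in_itv/= andbT => xy; apply: hC; exact: lt_trans xy.
rewrite RintegralZl//; last exact: integrable_expR_tail.
by rewrite /Rintegral ge0_integral_expR_tail.
Qed.

Lemma Rintegral_head_le C phi x : 0 < x -> expdecay phi ->
  (forall y, 0 < y -> `|phi y| <= C) ->
  `|\int[mu]_(y in `]0, x]) phi y| <= C * x.
Proof.
move=> x0 ephi hC.
have iphi := expdecay_integrableS (measurable_itv _) (@sub_itv_oc_Rpos x) ephi.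
have mux : mu `]0, x] = x%:E.
  by rewrite lebesgue_measure_itv/= lte_fin x0 -EFinB subr0.
apply: le_trans (le_normr_Rintegral _ iphi) _ => //.
apply: (@le_trans _ _ (\int[mu]_(y in `]0, x]) C)).
  apply: le_Rintegral => //.
  - exact: integrable_norm.
  - apply: measurable_bounded_integrable => //.
      by rewrite [ltLHS]mux ltry.
    exists `|C|; split; [exact: num_real|by move=> M /ltW CM y _].

  - by move=> y /=; rewrite in_itv/= => /andP[y0 _]; exact: hC.
by rewrite Rintegral_cst// [X in fine X]mux.
Qed.


Lemma eq_of_le_eps (u v C b : R) : 0 < b ->
  (forall e, 0 < e -> e < b -> `|u - v| <= C * e) -> u = v.
Proof.
move=> b0 uv; apply/eqP; rewrite -subr_eq0 -normr_le0 leNgt; apply/negP => p.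
(* A positive distance p = |u - v| contradicts the bound as soon as C e <= p / 2. *)
pose e := Num.min (b / 2) (`|u - v| / (2 * (`|C| + 1))).
have C1 : 0 < `|C| + 1 by rewrite ltr_wpDl.
have e0 : 0 < e by rewrite lt_min !divr_gt0// mulr_gt0.
have eb : e < b by rewrite gt_min ltr_pdivrMr// ltr_pMr// ltr1n.
have := uv _ e0 eb; apply/negP; rewrite -ltNge.
apply: (@le_lt_trans _ _ ((`|C| + 1) * e)).
  by rewrite ler_pM2r// (le_trans (ler_norm _))// lerDl.
apply: (@le_lt_trans _ _ (`|u - v| / 2)).
  rewrite -ler_pdivlMl// mulrC -mulrA -invfM.
  by rewrite ge_min lexx orbT.
by rewrite ltr_pdivrMr// ltr_pMr// ltr1n.
Qed.

Lemma FTC_itv G g x e : 0 < e -> e < x ->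
  (forall y, 0 < y -> is_derive y 1 G (g y)) ->
  (forall y, 0 < y -> {for y, continuous g}) -> expdecay g ->
  \int[mu]_(y in `]e, x]) g y = G x - G e.
Proof.
move=> e0 ex dG cg eg; have x0 : 0 < x by exact: lt_trans ex.
have ig : mu.-integrable `]e, x] (EFin \o g).
  apply: expdecay_integrableS => // y /=; rewrite !in_itv/= andbT => /andP[].
  by move=> /(lt_trans e0).
rewrite Rintegral_itv_obnd_cbnd// /Rintegral (@continuous_FTC2 _ g G e x)//.
- apply: continuous_in_subspaceT => y; rewrite inE/= in_itv/= => /andP[ey _].
  by apply: cg; exact: lt_le_trans ey.
- split.
  + move=> y; rewrite in_itv/= => /andP[ey _].
    by have [] := dG _ (lt_trans e0 ey).
  + by apply: cvg_at_right_filter; exact: (is_derive_continuous (dG _ e0)).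
  + by apply: cvg_at_left_filter; exact: (is_derive_continuous (dG _ x0)).
- move=> y; rewrite in_itv/= => /andP[ey _].
  by rewrite derive1E; have [_ ->] := dG _ (lt_trans e0 ey).
Qed.

(** The bound on G x / x makes G vanish at 0; the part of the integral over ]0, e] and
G e are both O(e), so the formula on [e, x] passes to the limit. *)
Lemma FTC_Rpos_head G g c : 0 < c ->
  (forall x, 0 < x -> is_derive x 1 G (g x)) ->
  (forall x, 0 < x -> {for x, continuous g}) ->
  expbnd (- c) (fun x => G x / x) -> expbnd (- c) g ->
  forall x, 0 < x -> \int[mu]_(y in `]0, x]) g y = G x.
Proof.
move=> c0 dG cg /expbnd_ge0[C C0 hC] bg x x0.
have eg : expdecay g by exact: expdecay_continuous bg.
have [C' C'0 hC'] := expbnd_ge0 bg.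
apply: (@eq_of_le_eps _ _ (C + C') x) => // e e0 ex.
have eg1 : expdecay g by exact: expdecay_continuous bg.
have ig : mu.-integrable `]0, x] (EFin \o g).
  by apply: expdecay_integrableS => //; exact: sub_itv_oc_Rpos.
have := @Rintegral_itvB R g (BRight 0) (BRight x) e ig.
rewrite !bnd_simp ltW// ltW// => /(_ isT isT); rewrite (FTC_itv e0 ex dG)// => h.
have -> : \int[mu]_(y in `]0, x]) g y - G x = \int[mu]_(y in `]0, e]) g y - G e.
  by move/eqP: h; rewrite subr_eq => /eqP ->; ring.
have eR y : 0 < y -> expR (- c * y) <= 1.
  by move=> y0; rewrite expR_le1 mulNr oppr_le0 mulr_ge0 ?ltW.
rewrite (le_trans (ler_normB _ _))// addrC mulrDl lerD//.
  have := hC _ e0; rewrite normrM normfV (gtr0_norm e0) ler_pdivrMr// => /le_trans.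
  by apply; rewrite ler_pM2r// ler_piMr ?eR// ltW.
apply: Rintegral_head_le => // y y0; apply: le_trans (hC' _ y0) _.
by rewrite ler_piMr ?eR// ltW.
Qed.

(** Here G vanishes at both ends.  Taking x = 1/e turns the decay at infinity into a
bound that is linear in e. *)
Lemma FTC_Rpos G g c : 0 < c ->
  (forall x, 0 < x -> is_derive x 1 G (g x)) ->
  (forall x, 0 < x -> {for x, continuous g}) ->
  expbnd (- c) (fun x => G x / x) -> expbnd (- c) g ->
  \Int g = 0.
Proof.
move=> c0 dG cg bG bg; have eg : expdecay g by exact: expdecay_continuous bg.
have [C C0 hC] := expbnd_ge0 bG; have [C' C'0 hC'] := expbnd_ge0 bg.
apply: (@eq_of_le_eps _ _ (C * (2 / c ^+ 2) + C' / c ^+ 2) 1) => // e e0 _.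
have x0 : 0 < e^-1 by rewrite invr_gt0.
rewrite subr0 (Rpos_split x0 eg) (FTC_Rpos_head c0 dG cg bG bg x0).
have dec n : expR (- c * e^-1) <= n`!%:R / c ^+ n * e ^+ n.
  have -> : n`!%:R / c ^+ n * e ^+ n = n`!%:R / (c * e^-1) ^+ n.
    by rewrite exprMn exprVn invfM invrK mulrA.
  rewrite mulNr expRN -[leLHS]mul1r ler_pdivrMr ?expR_gt0// mulrAC.
  rewrite ler_pdivlMr ?mul1r.
    by rewrite exprn_le_expR// mulr_ge0// ltW.
  by rewrite exprn_gt0// mulr_gt0.
have ne : e != 0 by rewrite gt_eqF.
have nc : c != 0 by rewrite gt_eqF.
rewrite (le_trans (ler_normD _ _))// mulrDl lerD//.
  have := hC _ x0; rewrite normrM normfV (gtr0_norm x0) ler_pdivrMr// => /le_trans.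
  apply; have -> : C * (2 / c ^+ 2) * e = C * (2`!%:R / c ^+ 2 * e ^+ 2) * e^-1.
    by rewrite -[2`!]/2%N; field; rewrite ne.
  by rewrite ler_pM2r// ler_pM2l.
apply: le_trans (Rintegral_tail_le c0 x0 eg hC') _.
have -> : C' / c ^+ 2 * e = C' * (1`!%:R / c ^+ 1 * e ^+ 1 / c).
  by rewrite -[1`!]/1%N; field.
by rewrite ler_pM2l// ler_pM2r ?invr_gt0.
Qed.

End ExponentialDecay.

(** * Term-by-term integration of dominated series *)

Section DominatedSeries.
Context {R : realType}.
Implicit Types (c d x y a : R) (phi psi G g : R -> R) (E : set R).

Local Notation mu := (@lebesgue_measure R).
Local Notation Rpos := (`]0, +oo[%classic : set R).

(** Dominated convergence, specialised to real-valued functions and to the dominating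
functions C e^{-cx} that serve for every series below. *)
Lemma Rintegral_dominated_cvg E c C (s_ : nat -> R -> R) (s : R -> R) :
  measurable E -> E `<=` Rpos -> 0 < c -> (forall n, measurable_fun E (s_ n)) ->
  (forall x, E x -> s_ ^~ x @ \oo --> s x) ->
  (forall n x, E x -> `|s_ n x| <= C * expR (- c * x)) ->
  \int[mu]_(x in E) s_ n x @[n --> \oo] --> \int[mu]_(x in E) s x.
Proof.
move=> mE sE c0 ms sc sb.
have ms' : measurable_fun E s by apply: measurable_fun_cvg sc.
have iC : mu.-integrable E (EFin \o (fun y => C * expR (- c * y))).
  by apply: integrableS (integrable_CexpR_tail C 0 c0) => //.
have [is' _ h] : [/\ mu.-integrable E (EFin \o s),
    (\int[mu]_(x in E) `|(s_ n x)%:E - (s x)%:E| @[n --> \oo] --> 0)%E &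
    (\int[mu]_(x in E) (s_ n x)%:E @[n --> \oo] --> \int[mu]_(x in E) (s x)%:E)%E].
  apply: (@dominated_convergence _ _ _ mu E mE (fun n => EFin \o s_ n) (EFin \o s)
    (EFin \o (fun y => C * expR (- c * y)))) => //.
  - by move=> n; apply/measurable_EFinP; exact: ms.
  - by apply/measurable_EFinP; exact: ms'.
  - apply: aeW => x Ex; apply: cvg_EFin; first by near=> k.
    exact: sc.
  - by apply: aeW => x n Ex; rewrite lee_fin; exact: sb.
apply: fine_cvg; rewrite fineK//.
exact: integrable_fin_num.
Unshelve. all: by end_near. Qed.

Lemma series_le (u v : nat -> R) (k : R) n :
  (forall i, `|u i| <= v i * k) -> `|series u n| <= series v n * k.
Proof.
move=> uv; rewrite !seriesEnat/= (le_trans (ler_norm_sum _ _ _))// mulr_suml.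
by apply: ler_sum => i _; exact: uv.
Qed.

Section series.
Variables (c : R) (B : nat -> R) (v : nat -> R -> R).
Hypotheses (c0 : 0 < c) (mv : forall k, measurable_fun Rpos (v k)).
Hypothesis vB : forall k x, 0 < x -> `|v k x| <= B k * expR (- c * x).
Hypothesis cB : cvgn (series B).

Let B0 k : 0 <= B k.
Proof.
have := vB k ltr01; rewrite -ler_pdivrMr ?expR_gt0//; apply: le_trans.
by rewrite divr_ge0// expR_ge0.
Qed.

Let seriesB n : series B n <= limn (series B).
Proof.
apply: nondecreasing_cvgn_le => //; exact: nondecreasing_series.
Qed.

Lemma dominated_series_cvg x : 0 < x -> cvgn (series (v ^~ x)).
Proof.
move=> x0; apply: normed_cvg.
apply: (@series_le_cvg _ _ (fun k => expR (- c * x) * B k)) => //=.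
- by move=> k; rewrite mulr_ge0// expR_ge0.
- by move=> k; rewrite mulrC vB.
- rewrite (_ : (fun k => _) = expR (- c * x) *: B); last by apply/funext.
  exact: is_cvg_seriesZ.
Qed.

Let partial_le n x : 0 < x ->
  `|series (v ^~ x) n| <= limn (series B) * expR (- c * x).
Proof.
move=> x0; apply: le_trans (series_le n (fun k => vB k x0)) _.
by rewrite ler_wpM2r// expR_ge0.
Qed.

Let partial_measurable n : measurable_fun Rpos (fun x => series (v ^~ x) n).
Proof.
by rewrite /series/=; exact: measurable_sum.
Qed.

Lemma dominated_series_le x : 0 < x ->
  `|limn (series (v ^~ x))| <= limn (series B) * expR (- c * x).
Proof.
move=> x0; have cv := dominated_series_cvg x0.
have := cvg_norm cv; move=> /(_ _)/cvg_lim <- //.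
apply: limr_le; first by apply: is_cvg_norm.
by near=> n; exact: partial_le.
Unshelve. all: by end_near. Qed.

Lemma dominated_series_expdecay : expdecay (fun x => limn (series (v ^~ x))).
Proof.
split; last by exists c => //; exists (limn (series B)) => x; exact: dominated_series_le.
apply: (measurable_fun_cvg partial_measurable) => x.
by rewrite /= in_itv/= andbT => /dominated_series_cvg.
Qed.

(** The weight psi is there for two uses: psi = 1 on ]0, x] integrates a series term by
term, and psi a polynomial on the half-line computes its moments. *)
Lemma dominated_series_Rintegral E (psi : R -> R) d : d < c -> measurable E ->
  E `<=` Rpos -> measurable_fun Rpos psi -> expbnd d psi ->
  series (fun k => \int[mu]_(x in E) (v k x * psi x)) @ \oo -->
  \int[mu]_(x in E) (limn (series (v ^~ x)) * psi x).
Proof.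
move=> dc mE sE mpsi [C hC].
have ed k : expdecay (fun x => v k x * psi x).
  apply: (@expdecayM _ (- c) d) => //; first by rewrite addrC subr_lt0.
    by exists (B k) => x; exact: vB.
  by exists C.
have eser n : expdecay (fun x => series (v ^~ x) n * psi x) /\
    series (fun k => \int[mu]_(x in E) (v k x * psi x)) n =
    \int[mu]_(x in E) (series (v ^~ x) n * psi x).
  elim: n => [|n [ih1 ih2]].
    rewrite /series/=; split.
      by apply: eq_expdecay (expdecayZ 0 (ed 0)) => x _; rewrite big_geq// !mul0r.
    under [RHS]eq_Rintegral => x _ do rewrite big_geq// mul0r.
    by rewrite big_geq// Rintegral_cst// mul0r.
  have e1 x : series (v ^~ x) n.+1 * psi x = series (v ^~ x) n * psi x + v n x * psi x.
    by rewrite seriesSr mulrDl.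
  split; first by apply: eq_expdecay (expdecayD ih1 (ed n)) => x _; rewrite e1.
  rewrite seriesSr ih2; under [RHS]eq_Rintegral => x _ do rewrite e1.
  by rewrite RintegralD//; exact: expdecay_integrableS.
rewrite (_ : series _ = fun n => \int[mu]_(x in E) (series (v ^~ x) n * psi x)).
  apply: (@Rintegral_dominated_cvg _ (c - d) (limn (series B) * C)) => //.
  - by rewrite subr_gt0.
  - by move=> n; have [[m _] _] := eser n; exact: measurable_funS m.
  - move=> x /sE; rewrite /= in_itv/= andbT => /dominated_series_cvg cv.
    exact: cvgMl.
  - move=> n x /sE; rewrite /= in_itv/= andbT => x0.
    rewrite opprB addrC mulrDl expRD mulrACA normrM ler_pM//.
      exact: partial_le.
    exact: hC.
by apply/funext => n; have [_] := eser n.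
Qed.

End series.
End DominatedSeries.

(** * Laguerre polynomials and weighted Laguerre functions *)

Section LaguerreFunctions.
Context {R : realType}.
Implicit Types (c d x y a : R) (phi psi G g : R -> R) (k m n i : nat) (p : {poly R}).

Local Notation mu := (@lebesgue_measure R).
Local Notation Rpos := (`]0, +oo[%classic : set R).
Local Notation "'\Int' phi" := (\int[mu]_(x in Rpos) phi x) (at level 10).

Lemma is_derive_fM f g x (df dg : R) : is_derive x 1 f df -> is_derive x 1 g dg ->
  is_derive x 1 (fun y => f y * g y : R) (df * g x + f x * dg).
Proof.
move=> hf hg; apply: is_derive_eq (is_deriveM hf hg) _.
by rewrite /GRing.scale/=; ring.
Qed.

Definition gweight a x := x `^ a * expR (- x).

Lemma is_derive_expRN x : is_derive x 1 (fun y => expR (- y)) (- expR (- x)).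
Proof.
have := is_derive_expRM (- 1) x; rewrite !mulN1r.
by under eq_fun do rewrite mulN1r.
Qed.

Lemma powRS a x : 0 < x -> x `^ (a + 1) = x * x `^ a.
Proof.
move=> x0; rewrite powRD; last by rewrite (gt_eqF x0) implybT.
by rewrite powRr1 1?mulrC// ltW.
Qed.

Lemma gweightS a x : 0 < x -> gweight (a + 1) x = x * gweight a x.
Proof. by move=> x0; rewrite /gweight powRS// mulrA. Qed.

Lemma gweight_gt0 a x : 0 < x -> 0 < gweight a x.
Proof. by move=> x0; rewrite mulr_gt0 ?powR_gt0 ?expR_gt0. Qed.

Lemma is_derive_gweightM a p x : 0 < x ->
  is_derive x 1 (fun y => gweight (a + 1) y * p.[y])
    (gweight a x * (((a + 1)%:P - 'X) * p + 'X * p^`()).[x]).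
Proof.
move=> x0; have h1 := is_derive_fM (is_derive1_powR (a + 1) x0) (is_derive_expRN x).
have h2 := is_derive_fM h1 (is_derive_poly p x).
apply: is_derive_eq h2 _.
by rewrite !hornerE addrK /gweight powRS//; ring.
Qed.

(** The polynomial factor in the k-th derivative of x^{k+a} e^-x, namely
x^a e^-x times this polynomial.  Writing that function as
x^{(k-1)+(a+1)} e^-x makes the recursion lower k and raise a. *)
Fixpoint rodrigues_poly k a : {poly R} :=
  if k is k'.+1 then
    ((a + 1)%:P - 'X) * rodrigues_poly k' (a + 1) + 'X * (rodrigues_poly k' (a + 1))^`()
  else 1.

Lemma near_Rpos x : 0 < x -> \forall y \near x, 0 < y.
Proof. exact: lt_nbhsr. Qed.

(** The induction compares the two sides near x only, where the arguments are positive. *)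
Lemma rodrigues k a x : 0 < x ->
  derive1n k (fun y => y `^ (k%:R + a) * expR (- y)) x =
  gweight a x * (rodrigues_poly k a).[x].
Proof.
elim: k a x => [|k ih] a x x0; first by rewrite derive1n0 add0r hornerE mulr1.
rewrite derive1nS derive1E.
have [_ <-] := is_derive_gweightM a (rodrigues_poly k (a + 1)) x0.
apply: near_eq_derive; near=> y.
have y0 : 0 < y by near: y; exact: near_Rpos.
rewrite -ih//; congr (derive1n _ _ _); apply/funext => z.
by rewrite -natr1 -addrA (addrC 1).
Unshelve. all: by end_near. Qed.

Lemma rodrigues_poly_coef k a :
  (forall i, (k < i)%N -> (rodrigues_poly k a)`_i = 0) /\
  (rodrigues_poly k a)`_k = (-1) ^+ k.
Proof.
elim: k a => [|k ih] a /=.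
  by rewrite coef1 expr0; split => // -[|i]// _; rewrite coef1.
have [ih1 ih2] := ih (a + 1).
set q := rodrigues_poly k (a + 1) in ih1 ih2 *.
have e i : (((a + 1)%:P - 'X) * q + 'X * q^`())`_i.+1 =
   (a + 1) * q`_i.+1 - q`_i + q`_i.+1 *+ i.+1.
  by rewrite mulrBl !coefE.
split=> [[//|i] ki|].
  by rewrite e (ih1 _ (ltnW ki)) (ih1 _ ki) mulr0 subr0 mul0rn addr0.
by rewrite e ih1// ih2 mulr0 mul0rn addr0 sub0r exprS mulN1r.
Qed.

Definition laguerre_poly k a : {poly R} := k`!%:R^-1 *: rodrigues_poly k a.

Lemma laguerreE k a x : 0 < x -> laguerre k a x = (laguerre_poly k a).[x].
Proof.
move=> x0; rewrite /laguerre rodrigues// hornerZ powRN /gweight expRN.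
have := powR_gt0 a x0; have := expR_gt0 x => /lt0r_neq0 e0 /lt0r_neq0 p0.
by field; rewrite e0 p0 pnatr_eq0 -lt0n fact_gt0.
Qed.

(** The weight is kept inside the function: these are the functions that Rodrigues'
formula presents as derivatives. *)
Definition lagf k a x := gweight a x * (laguerre_poly k a).[x].

(** One more derivative in Rodrigues' formula: both sides are, up to factorials, the
(k+1)-st derivative of x^{k+1+a} e^-x.  It is the source of the
integrations by parts and of the pointwise bounds below. *)
Lemma is_derive_lagf k a x : 0 < x ->
  is_derive x 1 (lagf k (a + 1)) (k.+1%:R * lagf k.+1 a x).
Proof.
move=> x0; apply: is_derive_eq (is_derive_gweightM a _ x0) _.
rewrite /lagf /laguerre_poly !derivZ -!scalerAr -scalerDr -/(rodrigues_poly k.+1 a).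
rewrite !hornerZ factS natrM.
by rewrite /GRing.scale/=; congr (_ * _); rewrite mulrA invfM mulrA mulfV ?mul1r ?pnatr_eq0.
Qed.

Lemma gweight_expbnd c a : 0 <= a -> c < 1 -> expbnd (- c) (gweight a).
Proof.
move=> a0 c1; have -> : - c = (1 - c) + - 1 by ring.
apply: (@expbndM _ _ _ (fun x => x `^ a) (fun x => expR (- x))).
  by apply: expbnd_powR => //; rewrite subr_gt0.
by apply: eq_expbnd (expbnd_expR (-1)) => x _; rewrite mulN1r.
Qed.

Lemma gweight_poly_expbnd c a p : 0 <= a -> c < 1 ->
  expbnd (- c) (fun x => gweight a x * p.[x]).
Proof.
move=> a0 c1; pose e := (1 - c) / 2.
have e0 : 0 < e by rewrite divr_gt0// subr_gt0.
have -> : - c = - (c + e) + e by ring.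
by apply: expbndM (expbnd_poly _ e0); apply: gweight_expbnd => //; rewrite /e; lra.
Qed.

Lemma lagf_expbnd c k a : 0 <= a -> c < 1 -> expbnd (- c) (lagf k a).
Proof. exact: gweight_poly_expbnd. Qed.

Lemma lagf_div_expbnd c k a : 0 <= a -> c < 1 ->
  expbnd (- c) (fun x => lagf k (a + 1) x / x).
Proof.
move=> a0 c1; apply: eq_expbnd (gweight_poly_expbnd (laguerre_poly k (a + 1)) a0 c1).
by move=> x x0; rewrite /lagf gweightS//; field; rewrite gt_eqF.
Qed.

Lemma gweight_continuous a x : 0 < x -> {for x, continuous (gweight a)}.
Proof.
move=> x0; apply: (@is_derive_continuous _ _ _ _ (is_derive_fM
  (is_derive1_powR a x0) (is_derive_expRN x))).
Qed.

Lemma lagf_continuous k a x : 0 < x -> {for x, continuous (lagf k a)}.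
Proof.
move=> x0; apply: continuousM; first exact: gweight_continuous.
exact: continuous_horner.
Qed.

Lemma lagf_measurable k a : measurable_fun Rpos (lagf k a).
Proof. by apply: Rpos_continuous_measurable; exact: lagf_continuous. Qed.

End LaguerreFunctions.

(** * Integration by parts, orthogonality and norms *)

Section LaguerreIntegrals.
Context {R : realType}.
Implicit Types (c d x y a : R) (psi G g : R -> R) (phi : nat -> R -> R)
  (k m n i : nat) (p : {poly R}).

Local Notation mu := (@lebesgue_measure R).
Local Notation Rpos := (`]0, +oo[%classic : set R).
Local Notation "'\Int' phi" := (\int[mu]_(x in Rpos) phi x) (at level 10).

(** A function on the half-line given with all its derivatives phi i, each growing slowly
enough to be integrated against a Laguerre function. *)
Definition tame phi :=
  (forall i x, 0 < x -> is_derive x 1 (phi i) (phi i.+1 x)) /\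
  (forall i, expbnd (1 / 4) (phi i)).

Lemma tame_shift phi m : tame phi -> tame (fun i => phi (m + i)%N).
Proof. by move=> [h1 h2]; split => i; [move=> x; rewrite addnS; exact: h1|exact: h2]. Qed.

Lemma tame_poly p : tame (fun i x => (p^`(i)).[x]).
Proof.
split=> [i x x0|i]; last by apply: expbnd_poly.
by rewrite derivnS; exact: is_derive_poly.
Qed.

Lemma tame_continuous phi i x : tame phi -> 0 < x -> {for x, continuous (phi i)}.
Proof. by move=> [h _] x0; exact: is_derive_continuous (h i x x0). Qed.

Lemma tame_measurable phi i : tame phi -> measurable_fun Rpos (phi i).
Proof.
by move=> h; apply: Rpos_continuous_measurable => x; exact: tame_continuous.
Qed.

Lemma expdecay_tame_lagf phi i k a : 0 <= a -> tame phi ->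
  expdecay (fun x => phi i x * lagf k a x).
Proof.
move=> a0 tphi; apply: (@expdecayM _ (1/4) (- (1/2))).
- lra.
- exact: tame_measurable.
- exact: lagf_measurable.
- by case: tphi.
- by apply: lagf_expbnd => //; lra.
Qed.

(** The boundary terms vanish: at 0 because w_{a+1} contains a factor x, and at infinity
because of its exponential decay. *)
Lemma tame_lagf_ibp phi k a : 0 <= a -> tame phi ->
  k.+1%:R * \Int (fun x => phi 0%N x * lagf k.+1 a x) =
  - \Int (fun x => phi 1%N x * lagf k (a + 1) x).
Proof.
move=> a0 tphi; have [d1 b1] := tphi; have a1 : 0 <= a + 1 by rewrite addr_ge0.
have e1 := @expdecay_tame_lagf phi 1 k _ a1 tphi.
have e0 := @expdecay_tame_lagf phi 0 k.+1 _ a0 tphi.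
have dG x : 0 < x -> is_derive x 1 (fun x => phi 0%N x * lagf k (a + 1) x)
    (phi 1%N x * lagf k (a + 1) x + k.+1%:R * (phi 0%N x * lagf k.+1 a x)).
  move=> x0; apply: is_derive_eq (is_derive_fM (d1 0%N x x0) (is_derive_lagf k a x0)) _.
  by congr (_ + _); rewrite mulrCA.
have := @FTC_Rpos _ _ _ (1/4) _ dG; rewrite RintegralD//; last first.
- exact: expdecay_integrable (expdecayZ _ e0).
- exact: expdecay_integrable.
rewrite RintegralZl//; last exact: expdecay_integrable.
move=> h; apply/eqP; rewrite -addr_eq0 addrC; apply/eqP; apply: h.
- by lra.
- move=> x x0; apply: continuousD.
    by apply: continuousM; [exact: tame_continuous|exact: lagf_continuous].
  apply: continuousM; first exact: cst_continuous.
  by apply: continuousM; [exact: tame_continuous|exact: lagf_continuous].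
- have -> : - (1 / 4) = 1 / 4 + - (1 / 2) :> R by lra.
  apply: (eq_expbnd (phi := fun x => phi 0%N x * (lagf k (a + 1) x / x))).
    by move=> x _; rewrite mulrA.
  by apply: expbndM => //; apply: lagf_div_expbnd => //; lra.
- have -> : - (1 / 4) = 1 / 4 + - (1 / 2) :> R by lra.
  apply: expbndD; last apply: expbndZ.
    by apply: expbndM => //; apply: lagf_expbnd => //; lra.
  by apply: expbndM => //; apply: lagf_expbnd => //; lra.
Qed.

Lemma tame_lagf_ibpn phi i k m a : 0 <= a -> tame phi ->
  (k + m)`!%:R * \Int (fun x => phi i x * lagf (k + m) a x) =
  (-1) ^+ m * k`!%:R * \Int (fun x => phi (i + m)%N x * lagf k (a + m%:R) x).
Proof.
elim: m i a => [|m ih] i a a0 tphi; first by rewrite !addn0 addr0 mul1r.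
have := @tame_lagf_ibp _ (k + m) a a0 (tame_shift i tphi).
rewrite !addn0 !addn1 => h.
rewrite !addnS factS mulnC natrM -mulrA h mulrN ih//; last by rewrite addr_ge0.
rewrite exprS mulN1r !mulNr; congr (- (_ * _)).
by rewrite addSn -addrA (addrC 1) natr1.
Qed.

(** Integrate by parts k times: the k-th derivative of p is zero. *)
Lemma lagf_orthogonal k a p : 0 <= a -> (size p <= k)%N ->
  \Int (fun x => p.[x] * lagf k a x) = 0.
Proof.
move=> a0 pk; have := @tame_lagf_ibpn _ 0 0 k a a0 (tame_poly p).
rewrite /= !add0n.
have -> : \Int (fun x => (p^`(k)).[x] * lagf 0 (a + k%:R) x) = 0.
  rewrite (@eq_Rintegral _ _ _ mu _ (cst 0)) ?Rintegral_cst ?mul0r// => x _.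
  by rewrite derivn_poly0// horner0 mul0r.
rewrite mulr0 => /eqP.
by rewrite mulf_eq0 pnatr_eq0 -leqn0 leqNgt fact_gt0 => /eqP.
Qed.

Definition gmass a := \Int (gweight a).

Lemma lagf0 a : lagf 0 a = gweight a.
Proof. by apply/funext => x; rewrite /lagf /laguerre_poly/= invr1 scale1r hornerE mulr1. Qed.

Lemma gweight_expdecay a : 0 <= a -> expdecay (gweight a).
Proof.
move=> a0; apply: (@expdecay_continuous _ (1/2)); first by lra.
  by move=> x; exact: gweight_continuous.
by apply: gweight_expbnd => //; lra.
Qed.

(** The functional equation of Gamma is the orthogonality of L_1^a to the constants. *)
Lemma gmassS a : 0 <= a -> gmass (a + 1) = (a + 1) * gmass a.
Proof.
move=> a0; have := @lagf_orthogonal 1 a 1 a0; rewrite size_poly1 => /(_ isT).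
rewrite (@eq_Rintegral _ _ _ mu _ (fun x => (a + 1) * gweight a x - gweight (a + 1) x)).
  rewrite RintegralB//.
  - rewrite RintegralZl//; last exact/expdecay_integrable/gweight_expdecay.
    by move/eqP; rewrite subr_eq0 => /eqP.
  - exact/expdecay_integrable/expdecayZ/gweight_expdecay.
  - by apply/expdecay_integrable/gweight_expdecay; rewrite addr_ge0.
move=> x; rewrite inE/= in_itv/= andbT => x0; rewrite gweightS//=.
rewrite /lagf /laguerre_poly/= invr1 scale1r -polyC1 derivC.
move: (gweight a x) => w; rewrite !hornerE.
by ring.
Qed.

(** The weight is at least e^-2 on ]1, 2]. *)
Lemma gmass_gt0 a : 0 <= a -> 0 < gmass a.
Proof.
move=> a0; have ew := gweight_expdecay a0.
have w0 E : E `<=` Rpos -> 0 <= \int[mu]_(x in E) gweight a x.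
  move=> sE; apply: Rintegral_ge0 => x /sE; rewrite /= in_itv/= andbT => x0.
  exact/ltW/gweight_gt0.
have s12 : `]1, 2] `<=` Rpos.
  by move=> x /=; rewrite !in_itv/= andbT => /andP[/(lt_trans ltr01)].
have := @Rintegral_itvB R (gweight a) (BRight 0) (BRight 2) 1
  (expdecay_integrableS (measurable_itv _) (@sub_itv_oc_Rpos _ 2) ew).
rewrite !bnd_simp ler01 ler1n => /(_ isT isT) h.
rewrite /gmass (@Rpos_split _ _ 2)// ltr_pwDl ?w0//; last exact: sub_itv_oo_Rpos.
rewrite -[ltRHS](subrK (\int[mu]_(x in `]0, 1]) gweight a x)) ltr_pwDl ?w0//; last first.
  exact: sub_itv_oc_Rpos.
rewrite h; apply: (@lt_le_trans _ _ (\int[mu]_(x in `]1, 2]) (expR (- 2)))).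
  rewrite Rintegral_cst// [X in fine X]lebesgue_measure_itv/= lte_fin ltr1n/=.
  by rewrite mulr_gt0 ?expR_gt0// subr_gt0 ltr1n.
apply: le_Rintegral => //.
- apply: measurable_bounded_integrable => //.
    by rewrite [ltLHS]lebesgue_measure_itv/= lte_fin ltr1n/= -EFinB ltry.
  by exists `|expR (- 2)|; split; [exact: num_real|move=> M /ltW CM y _].
- exact: expdecay_integrableS.
- move=> x /=; rewrite in_itv/= => /andP[x1 x2].
  rewrite -[leLHS]mul1r ler_pM ?expR_ge0 ?ler_expR ?lerN2//.
  by rewrite -(powRr0 x) ler_powR// ltW.
Qed.

Lemma gmass_Gamma a : gmass a = Gamma (a + 1).
Proof. by rewrite /Gamma addrK. Qed.

Definition sqnorm_lag k a := \Int (fun x => (laguerre_poly k a).[x] * lagf k a x).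

(** Integrate by parts k times: the k-th derivative of the Laguerre polynomial is the
constant (-1)^k, which leaves the integral of w_{a+k}. *)
Lemma sqnorm_lagE k a : 0 <= a -> sqnorm_lag k a = gmass (a + k%:R) / k`!%:R.
Proof.
move=> a0; have := @tame_lagf_ibpn _ 0 0 k a a0 (tame_poly (laguerre_poly k a)).
rewrite /= !add0n mulr1 lagf0.
have -> : derivn k (laguerre_poly k a) = ((-1) ^+ k)%:P.
  have [h1 h2] := rodrigues_poly_coef k a.
  apply/polyP => i; rewrite coef_derivn coefC /laguerre_poly coefZ.
  case: i => [|i] /=; last by rewrite h1 ?mulr0 ?mul0rn// addnS ltnS leq_addr.
  rewrite addn0 h2 ffactnn -[LHS]mulr_natl mulVKf//.
rewrite [X in _ = _ * X](@eq_Rintegral _ _ _ mu _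
  (fun x => (-1) ^+ k * gweight (a + k%:R) x)); last by move=> x _; rewrite hornerC.
rewrite RintegralZl//; last first.
  by apply/expdecay_integrable/gweight_expdecay; rewrite addr_ge0.
rewrite mulrA -expr2 sqrr_sign mul1r => h.
have -> : gmass (a + k%:R) = k`!%:R * sqnorm_lag k a by exact: esym h.
by rewrite mulrAC mulfV ?mul1r// pnatr_eq0 -lt0n fact_gt0.
Qed.

Lemma sqnorm_lagS k a : 0 <= a ->
  sqnorm_lag k.+1 a = sqnorm_lag k a * ((a + k.+1%:R) / k.+1%:R).
Proof.
move=> a0; rewrite !sqnorm_lagE// -natr1 addrA gmassS ?addr_ge0//.
rewrite factS natrM -natr1; field.
by rewrite natr1 !pnatr_eq0 /= -lt0n fact_gt0.
Qed.

Lemma sqnorm_lag0 a : 0 <= a -> sqnorm_lag 0 a = gmass a.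
Proof. by move=> a0; rewrite sqnorm_lagE// addr0 divr1. Qed.

Lemma sqnorm_lag_gt0 k a : 0 <= a -> 0 < sqnorm_lag k a.
Proof.
by move=> a0; rewrite sqnorm_lagE// divr_gt0 ?gmass_gt0 ?addr_ge0// ltr0n fact_gt0.
Qed.

Lemma sqnorm_lag_ge k a : 0 <= a -> gmass a <= sqnorm_lag k a.
Proof.
move=> a0; elim: k => [|k ih]; first by rewrite sqnorm_lag0.
rewrite sqnorm_lagS// (le_trans ih)// ler_peMr//; first exact/ltW/sqnorm_lag_gt0.
by rewrite ler_pdivlMr ?ltr0n// mul1r lerDr.
Qed.

(** Each step multiplies the norm by 1 + a/(k+1), which is at most (1 + 1/(k+1))^A by
the Bernoulli inequality. *)
Lemma sqnorm_lag_le k a A : 0 <= a -> a <= A%:R ->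
  sqnorm_lag k a <= gmass a * k.+1%:R ^+ A.
Proof.
move=> a0 aA; elim: k => [|k ih]; first by rewrite sqnorm_lag0// expr1n mulr1.
rewrite sqnorm_lagS//; apply: (@le_trans _ _ (gmass a * k.+1%:R ^+ A * (k.+2%:R / k.+1%:R) ^+ A)).
  apply: ler_pM => //; first exact/ltW/sqnorm_lag_gt0.
    by rewrite divr_ge0// addr_ge0.
  have -> : k.+2%:R / k.+1%:R = 1 + k.+1%:R^-1 :> R.
    by rewrite -(natr1 k.+1) mulrDl mul1r divff// pnatr_eq0.
  apply: (@le_trans _ _ (1 + k.+1%:R^-1 *+ A)).
    by rewrite mulrDl divff ?pnatr_eq0// addrC lerD2l -[leRHS]mulr_natl ler_wpM2r.
  have b0 : 0 <= k.+1%:R^-1 :> R by [].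
  elim: (A) => [|B ihB]; first by rewrite mulr0n addr0.
  rewrite exprS mulrSr addrA.
  apply: (@le_trans _ _ ((1 + k.+1%:R^-1) * (1 + k.+1%:R^-1 *+ B))); last first.
    by rewrite ler_wpM2l// addr_ge0.
  rewrite mulrDl mul1r mulrDr mulr1 addrA lerDl mulr_ge0// mulrn_wge0//.
rewrite le_eqVlt expr_div_n -mulrA [X in gmass a * X]mulrCA.
by rewrite mulfV ?mulr1 ?eqxx// expf_neq0// pnatr_eq0.
Qed.

Lemma weighted_amgm (w q s m : R) : 0 < w -> 0 < m ->
  `|s * (w * q)| <= 2^-1 * (m^-1 * (q * (w * q)) + m * (s ^+ 2 * w)).
Proof.
move=> w0 m0; rewrite !normrM (gtr0_norm w0).
have -> : 2^-1 * (m^-1 * (q * (w * q)) + m * (s ^+ 2 * w)) =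
    w * ((m^-1 * q ^+ 2 + m * s ^+ 2) / 2) by field; rewrite gt_eqF.
rewrite mulrCA ler_pM2l// -(real_normK (num_real q)) -(real_normK (num_real s)).
have -> : (m^-1 * `|q| ^+ 2 + m * `|s| ^+ 2) / 2 =
    `|s| * `|q| + (`|q| - m * `|s|) ^+ 2 / (2 * m) by field; rewrite gt_eqF.
by rewrite lerDl divr_ge0 ?sqr_ge0// mulr_ge0// ltW.
Qed.

(** The inequality between the arithmetic and geometric means replaces the
Cauchy-Schwarz inequality; the free parameter m is chosen later according to k. *)
Lemma lagf_amgm psi k a (m : R) : 0 <= a -> 0 < m -> measurable_fun Rpos psi ->
  expbnd (1 / 4) psi ->
  expdecay (fun x => psi x ^+ 2 * gweight a x) /\
  \Int (fun x => `|psi x * lagf k a x|) <=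
    (sqnorm_lag k a / m + m * \Int (fun x => psi x ^+ 2 * gweight a x)) / 2.
Proof.
move=> a0 m0 mpsi bpsi.
have e1 : expdecay (fun x => psi x ^+ 2 * gweight a x).
  apply: (@expdecayM _ (1/2) (- (3/4))); first by lra.
  - exact: measurable_funX.
  - by have [] := gweight_expdecay a0.
  - have -> : 1 / 2 = 1 / 4 + 1 / 4 :> R by lra.
    by apply: eq_expbnd (expbndM bpsi bpsi) => x _; rewrite expr2.
  - by apply: gweight_expbnd => //; lra.
split=> //.
have e2 : expdecay (fun x => (laguerre_poly k a).[x] * lagf k a x).
  exact: (@expdecay_tame_lagf _ 0 k a a0 (tame_poly (laguerre_poly k a))).
have e3 : expdecay (fun x => `|psi x * lagf k a x|).
  apply/expdecay_norm/(@expdecayM _ (1/4) (- (1/2))) => //; first by lra.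
    exact: lagf_measurable.
  by apply: lagf_expbnd => //; lra.
pose F x := 2^-1 * (m^-1 * ((laguerre_poly k a).[x] * lagf k a x) +
            m * (psi x ^+ 2 * gweight a x)).
apply: (@le_trans _ _ (\Int F)).
  apply: le_Rintegral => //.
  - exact: expdecay_integrable.
  - exact/expdecay_integrable/expdecayZ/expdecayD/expdecayZ/e1/expdecayZ/e2.
  - move=> x /=; rewrite in_itv/= andbT => x0; rewrite /F /lagf.
    by apply: weighted_amgm => //; exact: gweight_gt0.
rewrite /F RintegralZl ?RintegralD ?RintegralZl//.
- by rewrite mulrC (mulrC m^-1).
- exact: expdecay_integrable.
- exact: expdecay_integrable.
- exact/expdecay_integrable/expdecayZ.
- exact/expdecay_integrable/expdecayZ.
- exact/expdecay_integrable/expdecayD/expdecayZ/e1/expdecayZ/e2.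
Qed.

End LaguerreIntegrals.

(** * Uniform bounds for the weighted Laguerre functions *)

Section LaguerreEstimates.
Context {R : realType}.
Implicit Types (a b c d x y : R) (psi G g : R -> R) (phi : nat -> R -> R)
  (k m n i : nat) (p : {poly R}).

Local Notation mu := (@lebesgue_measure R).
Local Notation Rpos := (`]0, +oo[%classic : set R).
Local Notation "'\Int' phi" := (\int[mu]_(x in Rpos) phi x) (at level 10).

Lemma expR_growth_measurable c : measurable_fun Rpos (fun x => expR (c * x)).
Proof.
by apply: Rpos_continuous_measurable => x _; exact: is_derive_continuous (is_derive_expRM c x).
Qed.

Lemma lagf_expR_integral k a : 0 <= a ->
  expdecay (fun x => expR (1 / 4 * x) * lagf k a x).
Proof.
move=> a0; apply: (@expdecayM _ (1 / 4) (- (1 / 2))); first by lra.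
- exact: expR_growth_measurable.
- exact: lagf_measurable.
- exact: expbnd_expR.
- by apply: lagf_expbnd => //; lra.
Qed.

(** Integrate the derivative of e^{y/4} w_{a+1} L_k^{a+1}(y) over ]0, x] and bound by the
integral over the whole half-line; dividing by e^{x/4} leaves the decay. *)
Lemma lagf_pointwise_integral k a x : 0 <= a -> 0 < x ->
  `|lagf k (a + 1) x| <=
  (\Int (fun x => `|expR (1 / 4 * x) * lagf k (a + 1) x|) +
   k.+1%:R * \Int (fun x => `|expR (1 / 4 * x) * lagf k.+1 a x|)) * expR (- (1 / 4) * x).
Proof.
move=> a0 x0; have a1 : 0 <= a + 1 by rewrite addr_ge0.
have e1 := lagf_expR_integral k a1; have e0 := lagf_expR_integral k.+1 a0.
pose g y : R := 1 / 4 * (expR (1 / 4 * y) * lagf k (a + 1) y) +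
  k.+1%:R * (expR (1 / 4 * y) * lagf k.+1 a y).
have dG y : 0 < y -> is_derive y 1 (fun y => expR (1 / 4 * y) * lagf k (a + 1) y) (g y).
  move=> y0; apply: is_derive_eq (is_derive_fM (is_derive_expRM (1 / 4) y) (is_derive_lagf k a y0)) _.
  by rewrite /g; ring.
have eg : expdecay g by apply: expdecayD; exact: expdecayZ.
have := @FTC_Rpos_head _ _ _ (1/4) _ dG; move=> /(_ _ _ _ _ x x0) h.
rewrite mulNr expRN ler_pdivlMr ?expR_gt0// mulrC.
have -> : expR (1 / 4 * x) * `|lagf k (a + 1) x| = `|\int[mu]_(y in `]0, x]) g y|.
  rewrite h ?normrM ?(ger0_norm (expR_ge0 _))//.
  - move=> y y0; rewrite /g.
    have ce : {for y, continuous (fun y => expR (1 / 4 * y) : R)}.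
      exact: is_derive_continuous (is_derive_expRM (1 / 4) y).
    apply: continuousD; (apply: continuousM; first exact: cst_continuous);
      by apply: continuousM => //; exact: lagf_continuous.
  - have -> : - (1 / 4) = 1 / 4 + - (1 / 2) :> R by lra.
    apply: (eq_expbnd (phi := fun x => expR (1 / 4 * x) * (lagf k (a + 1) x / x))).
      by move=> y _; rewrite mulrA.
    by apply: expbndM; [exact: expbnd_expR|apply: lagf_div_expbnd => //; lra].
  - have -> : - (1 / 4) = 1 / 4 + - (1 / 2) :> R by lra.
    by apply: expbndD; apply: expbndZ; (apply: expbndM;
      [exact: expbnd_expR|apply: lagf_expbnd => //; lra]).
have ih : expdecay (fun x => `|g x|) by exact: expdecay_norm.
have ig0 : mu.-integrable `]0, x] (EFin \o g).
  by apply: expdecay_integrableS => //; exact: sub_itv_oc_Rpos.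
apply: le_trans (le_normr_Rintegral _ ig0) _ => //.
apply: (@le_trans _ _ (\Int (fun x => `|g x|))).
  rewrite (Rpos_split x0 ih) lerDl; apply: Rintegral_ge0 => y _; exact: normr_ge0.
apply: (@le_trans _ _ (\Int (fun y => `|expR (1 / 4 * y) * lagf k (a + 1) y| +
   k.+1%:R * `|expR (1 / 4 * y) * lagf k.+1 a y|))).
  apply: le_Rintegral => //.
  - exact: expdecay_integrable.
  - by apply/expdecay_integrable/expdecayD; [exact: expdecay_norm|exact/expdecayZ/expdecay_norm].
  - move=> y _; rewrite /g (le_trans (ler_normD _ _))// lerD//.
      by rewrite normrM ler_piMl// ger0_norm; lra.
    by rewrite normrM ger0_norm.
rewrite RintegralD//.
- by rewrite RintegralZl//; exact/expdecay_integrable/expdecay_norm.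
- exact/expdecay_integrable/expdecay_norm.
- exact/expdecay_integrable/expdecayZ/expdecay_norm.
Qed.

(** Both integrals in the previous bound are controlled by the squared norms, which grow
polynomially in k. *)
Lemma lagf_bound a : 0 <= a -> exists A : nat, exists2 C, 0 <= C &
  forall k x, 0 < x ->
    `|lagf k (a + 1) x| <= C * k.+1%:R ^+ A * expR (- (1 / 4) * x).
Proof.
move=> a0; have a1 : 0 <= a + 1 by rewrite addr_ge0.
have [A aA] : exists A : nat, a + 1 <= A%:R.
  by exists (Num.truncn (a + 1)).+1; rewrite ltW// truncnS_gt.
(* The constant left by lagf_amgm for parameter 1 and psi = e^{x/4}. *)
pose E b := \Int (fun x => (expR (1 / 4 * x)) ^+ 2 * gweight b x).
have E0 b : 0 <= E b.
  apply: Rintegral_ge0 => x; rewrite /= in_itv/= andbT => x0.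
  by rewrite mulr_ge0 ?sqr_ge0// ltW// gweight_gt0.
have bnd k b : 0 <= b -> \Int (fun x => `|expR (1 / 4 * x) * lagf k b x|) <=
    sqnorm_lag k b + E b.
  move=> b0; have [_] := lagf_amgm k b0 ltr01
    (expR_growth_measurable (1 / 4)) (expbnd_expR (1 / 4)).
  rewrite -/(E b) => /le_trans; apply; rewrite divr1 (mul1r (E b)) ler_pdivrMr//.
  by rewrite ler_peMr ?ler1n// addr_ge0// ltW// sqnorm_lag_gt0.
have gm1 := gmass_gt0 a1; have gm0 := gmass_gt0 a0.
pose K := (gmass (a + 1) + E (a + 1)) + (gmass a * 2 ^+ A + E a).
exists A.+1; exists K.
  by rewrite /K !addr_ge0 ?mulr_ge0 ?exprn_ge0 ?E0// ltW.
move=> k x x0; apply: le_trans (lagf_pointwise_integral k a0 x0) _.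
rewrite ler_wpM2r ?expR_ge0//.
have s1 : 1 <= k.+1%:R :> R by rewrite ler1n.
have sA : 1 <= k.+1%:R ^+ A :> R by rewrite exprn_ege1.
have sA1 : k.+1%:R ^+ A <= k.+1%:R ^+ A.+1 :> R by rewrite ler_weXn2l.
rewrite /K mulrDl lerD//.
  apply: le_trans (bnd k _ a1) _; rewrite mulrDl lerD//.
    apply: le_trans (sqnorm_lag_le k a1 aA) _.
    by rewrite ler_wpM2l// ltW.
  by rewrite ler_peMr// (le_trans sA).
rewrite exprS mulrCA ler_wpM2l//.
apply: le_trans (bnd k.+1 _ a0) _; rewrite mulrDl lerD ?ler_peMr//.
have aA' : a <= A%:R by rewrite (le_trans _ aA)// lerDl.
apply: le_trans (sqnorm_lag_le k.+1 a0 aA') _.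
rewrite -mulrA ler_wpM2l ?(ltW gm0)// -exprMn lerXn2r ?nnegrE// ?mulr_ge0//.
by rewrite -natrM ler_nat mul2n -addnn addSn ltnS leq_addl.
Qed.

Lemma cvg_series_invr_sqr : cvgn (series (fun k => (k.+1%:R ^+ 2)^-1 : R)).
Proof.
apply: nondecreasing_is_cvgn.
  by apply: nondecreasing_series => n _ _; rewrite invr_ge0 exprn_ge0.
exists 2 => _ [n _ <-]; apply: (@le_trans _ _ (2 * (1 - n.+1%:R^-1))); last first.
  by rewrite mulrBr mulr1 lerBlDr lerDl mulr_ge0.
elim: n => [|n ih]; first by rewrite seriesEnat/= big_geq// invr1 subrr mulr0.
rewrite seriesSr (le_trans (lerD ih (lexx _)))//.
have h1 : 0 < n.+1%:R :> R by []. have h2 : 0 < n.+2%:R :> R by [].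
rewrite -subr_ge0.
have -> : 2 * (1 - n.+2%:R^-1) - (2 * (1 - n.+1%:R^-1) + (n.+1%:R ^+ 2)^-1) =
   n%:R / (n.+1%:R ^+ 2 * n.+2%:R) :> R.
  by rewrite -(natr1 n.+1) -(natr1 n); field; rewrite !natr1 !pnatr_eq0.
by rewrite divr_ge0// mulr_ge0// exprn_ge0.
Qed.

End LaguerreEstimates.

(** * Decay of Laguerre coefficients *)

Section Decay.
Context {R : realType}.
Implicit Types (a b c d x y : R) (psi G g : R -> R) (phi : nat -> R -> R)
  (k m n i : nat) (p : {poly R}).

Local Notation mu := (@lebesgue_measure R).
Local Notation Rpos := (`]0, +oo[%classic : set R).
Local Notation "'\Int' phi" := (\int[mu]_(x in Rpos) phi x) (at level 10).

(** The Laguerre coefficients of the function phi 0, whose derivatives are the phi i. *)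
Definition lcoef phi a k := \Int (fun x => phi 0%N x * lagf k a x) / sqnorm_lag k a.

Lemma fact_ratio_ge j m : ((j + m).+1 ^ m * j`! <= m.+1 ^ m * (j + m)`!)%N.
Proof.
have h : ((j.+1) ^ m * j`! <= (j + m)`!)%N.
  elim: m => [|m ih]; first by rewrite addn0 mul1n.
  rewrite addnS factS expnS -mulnA leq_mul// ltnS; exact: leq_addr.
apply: (@leq_trans ((m.+1 * j.+1) ^ m * j`!)%N).
  rewrite leq_mul2r; apply/orP; right; case: m {h} => // m; rewrite leq_exp2r//.
  by rewrite mulSn -addSn leq_add2l leq_pmulr.
by rewrite expnMn -mulnA leq_mul2l h orbT.
Qed.

(** After m = 2s integrations by parts the k-th coefficient is paired with
L_{k-m}^{a+m}, and (k-m)!/k! times the squared norm of L_{k-m}^{a+m} for w_{a+m} is the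
squared norm of L_k^a for w_a.  The choice
(k+1)^s for the parameter of lagf_amgm balances its two terms, each of which becomes
O((k+1)^-s). *)
Lemma lcoef_decay phi a s : 0 <= a -> tame phi ->
  exists2 C, 0 <= C & forall k, `|lcoef phi a k| * k.+1%:R ^+ s <= C.
Proof.
move=> a0 tphi; have [m em] : exists m, m = (s + s)%N by exists (s + s)%N.
pose E := \Int (fun x => phi m x ^+ 2 * gweight (a + m%:R) x).
have E0 : 0 <= E.
  apply: Rintegral_ge0 => x; rewrite /= in_itv/= andbT => x0.
  by rewrite mulr_ge0 ?sqr_ge0// ltW// gweight_gt0.
have am : 0 <= a + m%:R by rewrite addr_ge0.
have gm := gmass_gt0 a0.
have main j : `|lcoef phi a (j + m)| * (j + m).+1%:R ^+ s <=
    1 + E / gmass a * m.+1%:R ^+ m.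
  set S : R := (j + m).+1%:R ^+ s; have S0 : 0 < S by rewrite exprn_gt0.
  set I := \Int (fun x => phi m x * lagf j (a + m%:R) x).
  have L0 := sqnorm_lag_gt0 (j + m) a0; set L := sqnorm_lag (j + m) a in L0 *.
  have f0 : 0 < (j + m)`!%:R :> R by rewrite ltr0n fact_gt0.
  have f1 : 0 < j`!%:R :> R by rewrite ltr0n fact_gt0.
  have eI : `|lcoef phi a (j + m)| = j`!%:R / (j + m)`!%:R * `|I| / L.
    rewrite /lcoef -/L normrM normfV (gtr0_norm L0); congr (_ / _).
    have /(congr1 Num.norm) := @tame_lagf_ibpn _ phi 0 j m a a0 tphi.
    rewrite !add0n -/I !normrM normrX normrN1 expr1n mul1r !normr_nat.
    by move=> h; rewrite mulrAC -h mulrAC mulfV ?mul1r// gt_eqF.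
  have bI : `|I| <= (sqnorm_lag j (a + m%:R) / S + S * E) / 2.
    have [_] := lagf_amgm j am S0 (tame_measurable m tphi) (tphi.2 m).
    apply: le_trans; apply: le_normr_Rintegral => //.
    exact: expdecay_integrable (expdecay_tame_lagf m j am tphi).
  have eL : sqnorm_lag j (a + m%:R) = L * (j + m)`!%:R / j`!%:R.
    rewrite /L !sqnorm_lagE// (natrD _ j m).
    rewrite (_ : a + (j%:R + m%:R) = a + m%:R + j%:R); last by ring.
    by field; rewrite !gt_eqF.
  have gL : gmass a <= L by exact: sqnorm_lag_ge.
  (* This is where m = 2s enters: S ^ 2 = (k+1)^m is of the order of k!/(k-m)!. *)
  have hf : S ^+ 2 * j`!%:R / (j + m)`!%:R <= m.+1%:R ^+ m.
    rewrite ler_pdivrMr// -exprM muln2 -addnn -em -!natrX -!natrM ler_nat.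
    exact: fact_ratio_ge.
  rewrite eI.
  apply: (@le_trans _ _ (j`!%:R / (j + m)`!%:R * ((sqnorm_lag j (a + m%:R) / S + S * E) / 2) / L * S)).
    rewrite ler_pM2r// ler_pM2r ?invr_gt0// ler_wpM2l// divr_ge0// ltW//.
  rewrite eL.
  have -> : j`!%:R / (j + m)`!%:R * ((L * (j + m)`!%:R / j`!%:R / S + S * E) / 2) / L * S =
    (1 + E / L * (S ^+ 2 * j`!%:R / (j + m)`!%:R)) / 2.
    by field; rewrite !gt_eqF.
  have M0 : 0 <= E / gmass a * m.+1%:R ^+ m.
    by rewrite mulr_ge0 ?exprn_ge0// divr_ge0// ltW.
  rewrite ler_pdivrMr// (@le_trans _ _ (1 + E / gmass a * m.+1%:R ^+ m))//.
    rewrite lerD2l ler_pM//.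
    - by rewrite divr_ge0// ltW.
    - by rewrite divr_ge0 ?mulr_ge0 ?exprn_ge0// ltW.
    - by rewrite ler_wpM2l// lef_pV2.
  by rewrite ler_peMr ?ler1n// addr_ge0.
have s0 k : 0 <= `|lcoef phi a k| * k.+1%:R ^+ s by rewrite mulr_ge0// exprn_ge0.
have M0 : 0 <= 1 + E / gmass a * m.+1%:R ^+ m.
  by rewrite addr_ge0// mulr_ge0 ?exprn_ge0// divr_ge0// ltW.
exists ((1 + E / gmass a * m.+1%:R ^+ m) +
   \sum_(i < m) `|lcoef phi a i| * i.+1%:R ^+ s).
  by rewrite addr_ge0// sumr_ge0.
move=> k; have [mk|km] := leqP m k.
  by rewrite -(subnK mk) (le_trans (main _))// lerDl sumr_ge0.
by rewrite (bigD1 (Ordinal km))//= addrCA lerDl addr_ge0// sumr_ge0.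
Qed.

End Decay.

(** * Determinacy of exponentially decaying densities by their moments *)

Section MomentDeterminacy.
Context {R : realType}.
Implicit Types (a b c d s x y z : R) (k m n i : nat) (p : {poly R}).

Local Notation mu := (@lebesgue_measure R).
Local Notation Rpos := (`]0, +oo[%classic : set R).
Local Notation "'\Int' phi" := (\int[mu]_(x in Rpos) phi x) (at level 10).

Variable rho : R -> R.
Hypothesis mrho : measurable_fun Rpos rho.
Hypothesis brho : expbnd (- (1 / 4)) rho.
Hypothesis rho_moment : forall p, \Int (fun x => rho x * p.[x]) = 0.

Let expdecay_rho_poly s p : 0 <= s -> expdecay (fun x => rho x * p.[x] * expR (- s * x)).
Proof.
move=> s0; apply: (@expdecayM _ (- (1/8)) 0); first by lra.
- apply: measurable_funM => //; apply: Rpos_continuous_measurable => x _.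
  exact: continuous_horner.
- exact: expR_growth_measurable.
- have -> : - (1 / 8) = - (1 / 4) + 1 / 8 :> R by lra.
  by apply: expbndM => //; apply: expbnd_poly; lra.
- by apply: expbndW (expbnd_expR (- s)); rewrite oppr_le0.
Qed.

Let exp_partial_poly c N : exists q : {poly R},
  forall x, q.[x] = series (exp_coeff (c * x)) N.
Proof.
elim: N => [|N [q hq]].
  by exists 0 => x; rewrite seriesEnat/= big_geq// horner0.
exists (q + (c ^+ N / N`!%:R) *: 'X^N) => x.
by rewrite seriesSr hornerD hq hornerZ hornerXn /exp_coeff/= exprMn mulrAC.
Qed.

Let exp_partial_le y N : `|series (exp_coeff y) N| <= expR `|y|.
Proof.
apply: (@le_trans _ _ (series (exp_coeff `|y|) N)).
  rewrite !seriesEnat/= (le_trans (ler_norm_sum _ _ _))//.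
  by apply: ler_sum => i _; rewrite normrM normfV normr_nat normrX.
rewrite /expR; apply: nondecreasing_cvgn_le; last exact: is_cvg_series_exp_coeff.
by apply: nondecreasing_series => n _ _; exact: exp_coeff_ge0.
Qed.

(** Multiply by the Taylor polynomials of e^{-cx}, which only change p; they are dominated
by e^{cx}, and this is beaten by the decay of rho because c is small. *)
Let laplace_step s c : 0 <= s -> 0 <= c -> c <= 1 / 16 ->
  (forall p, \Int (fun x => rho x * p.[x] * expR (- s * x)) = 0) ->
  forall p, \Int (fun x => rho x * p.[x] * expR (- (s + c) * x)) = 0.
Proof.
move=> s0 c0 c16 hs p.
pose s_ N x := rho x * p.[x] * expR (- s * x) * series (exp_coeff (- c * x)) N.
have sum0 N : \Int (s_ N) = 0.
  have [q hq] := exp_partial_poly (- c) N.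
  apply: etrans (hs (p * q)); apply: eq_Rintegral => x _.
  by rewrite /s_ -hq hornerM; ring.
have [C hC] : expbnd (- (1 / 8)) (fun x => rho x * p.[x] * expR (- s * x)).
  have -> : - (1 / 8) = - (1 / 4) + 1 / 8 + 0 :> R by lra.
  apply: expbndM; last by apply: expbndW (expbnd_expR (- s)); rewrite oppr_le0.
  by apply: expbndM => //; apply: expbnd_poly; lra.
have h := @Rintegral_dominated_cvg R Rpos (1 / 16) C s_
  (fun x => rho x * p.[x] * expR (- (s + c) * x)).
have : \Int (s_ n) @[n --> \oo] --> \Int (fun x => rho x * p.[x] * expR (- (s + c) * x)).
  apply: h => //.
  - move=> N; apply: measurable_funM; first by have [] := expdecay_rho_poly p s0.
    have [q hq] := exp_partial_poly (- c) N.
    apply: (@eq_measurable_fun _ _ _ _ _ (horner q)).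
      by move=> x _; rewrite hq.
    apply: Rpos_continuous_measurable => x _; exact: continuous_horner.
  - move=> x _; rewrite /s_ opprD mulrDl expRD mulrA.
    apply: cvgMr; rewrite /expR; exact: is_cvg_series_exp_coeff.
  - move=> N x; rewrite /= in_itv/= andbT => x0.
    rewrite /s_ normrM.
    have -> : - (1 / 16) * x = - (1 / 8) * x + 1 / 16 * x by lra.
    rewrite expRD mulrA ler_pM//; first exact: hC.
    apply: le_trans (exp_partial_le _ _) _.
    by rewrite ler_expR normrM normrN (ger0_norm c0) (gtr0_norm x0) ler_pM2r.
under eq_fun do rewrite sum0.
move=> /(cvg_unique _) /(_ (cvg_cst 0)).
by apply.
Qed.

(** Reach s by sufficiently many steps, each of length at most 1/16. *)
Let laplace0 s : 0 <= s -> \Int (fun x => rho x * expR (- s * x)) = 0.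
Proof.
move=> s0; pose J := (Num.truncn (16 * s)).+1.
have J0 : 0 < J%:R :> R by [].
pose c := s / J%:R; have c0 : 0 <= c by rewrite divr_ge0.
have c16 : c <= 1 / 16.
  rewrite ler_pdivrMr// mulrC mulrA mulr1 ler_pdivlMr// mulrC ltW//.
  exact: truncnS_gt.
have main i p : \Int (fun x => rho x * p.[x] * expR (- (i%:R * c) * x)) = 0.
  elim: i p => [|i ih] p.
    apply: etrans (rho_moment p); apply: eq_Rintegral => x _.
    by rewrite mul0r oppr0 mul0r expR0 mulr1.
  rewrite -natr1 mulrDl mul1r; apply: laplace_step => //; exact: mulr_ge0.
apply: etrans (main J 1); apply: eq_Rintegral => x _.
by rewrite hornerE mulr1 /c (mulrC J%:R) divfK ?gt_eqF.
Qed.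

(** Expanding one factor 1 - e^{-zx} at a time turns the claim for N + 1 into the claim
for N at s and at s + z. *)
Let kernel0 z N s : 0 <= z -> 0 <= s ->
  expdecay (fun x => rho x * expR (- s * x) * (1 - expR (- z * x)) ^+ N) /\
  \Int (fun x => rho x * expR (- s * x) * (1 - expR (- z * x)) ^+ N) = 0.
Proof.
move=> z0; elim: N s => [|N ih] s s0.
  split; last first.
    by apply: etrans (laplace0 s0); apply: eq_Rintegral => x _; rewrite expr0 mulr1.
  by apply: eq_expdecay (expdecay_rho_poly 1 s0) => x _; rewrite hornerE mulr1 expr0 mulr1.
have [e1 i1] := ih s s0; have [e2 i2] := ih (s + z) (addr_ge0 s0 z0).
have eqN x : rho x * expR (- s * x) * (1 - expR (- z * x)) ^+ N.+1 =
    rho x * expR (- s * x) * (1 - expR (- z * x)) ^+ N +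
    -1 * (rho x * expR (- (s + z) * x) * (1 - expR (- z * x)) ^+ N).
  by rewrite opprD mulrDl expRD exprS; ring.
split; first by apply: eq_expdecay (expdecayD e1 (expdecayZ (-1) e2)) => x _; rewrite eqN.
under eq_Rintegral => x _ do rewrite eqN.
rewrite RintegralD//; [|exact: expdecay_integrable|exact/expdecay_integrable/expdecayZ].
by rewrite RintegralZl ?i1 ?i2 ?mulr0 ?addr0//; exact: expdecay_integrable.
Qed.

Let bernoulli N z : 0 <= z <= 1 -> 1 - N%:R * z <= (1 - z) ^+ N.
Proof.
move=> /andP[z0 z1]; elim: N => [|N ih]; first by rewrite mul0r subr0.
have z1' : 0 <= 1 - z by rewrite subr_ge0.
rewrite exprS (le_trans _ (ler_wpM2l z1' ih))// -subr_ge0 -natr1.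
have -> : (1 - z) * (1 - N%:R * z) - (1 - (N%:R + 1) * z) = N%:R * z ^+ 2 by ring.
by rewrite mulr_ge0 ?sqr_ge0.
Qed.

(** By the Bernoulli inequality the kernel is at least 1 - (2w)^m. *)
Let kernel_cvg1 w : 0 <= w -> w < 1 / 2 ->
  (1 - w ^+ m) ^+ (2 ^ m) @[m --> \oo] --> (1 : R).
Proof.
move=> w0 w2; apply: (@squeeze_cvgr _ _ _ _ (fun m => 1 - (2 * w) ^+ m) (cst 1)).
- apply: nearW => m; have w1 : w <= 1 by lra.
  have wm : 0 <= w ^+ m <= 1 by rewrite exprn_ge0//= exprn_ile1.
  apply/andP; split; first by rewrite exprMn -natrX bernoulli.
  by rewrite exprn_ile1// ?subr_ge0 ?lerBlDr ?lerDl; case/andP: wm.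
- rewrite -[X in _ --> X]subr0; apply: cvgB; first exact: cvg_cst.
  by apply: cvg_expr; rewrite ger0_norm; lra.
- exact: cvg_cst.
Qed.

(** By 1 - z <= e^-z and 1 + z <= e^z, the kernel is at most (2w)^-m. *)
Let kernel_cvg0 w : 1 / 2 < w -> w <= 1 ->
  (1 - w ^+ m) ^+ (2 ^ m) @[m --> \oo] --> (0 : R).
Proof.
move=> w2 w1; have w0 : 0 <= w by lra.
apply: (@squeeze_cvgr _ _ _ _ (cst 0) (fun m => (2 * w)^-1 ^+ m)).
- apply: nearW => m; have wm : 0 <= w ^+ m <= 1 by rewrite exprn_ge0//= exprn_ile1.
  have wm' : 0 <= 1 - w ^+ m by rewrite subr_ge0; case/andP: wm.
  rewrite exprn_ge0//=.
  apply: (@le_trans _ _ (expR (- w ^+ m) ^+ (2 ^ m))).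
    by apply: lerXn2r; rewrite ?nnegrE ?expR_ge0// expR_ge1Dx.
  rewrite -expRM_natl mulrN expRN exprVn lef_pV2 ?posrE ?expR_gt0//; last first.
    by rewrite exprn_gt0//; lra.
  rewrite natrX -exprMn (le_trans _ (expR_ge1Dx _))// lerDr//.
- exact: cvg_cst.
- apply: cvg_expr; rewrite ger0_norm ?invr_ge0; last by lra.
  by rewrite invf_lt1; lra.
Qed.

(** The kernel is applied to w = e^{-by} with b = ln 2 / x, so that w < 1/2 exactly when
y > x: the kernels separate ]0, x[ from ]x, +oo[. *)
Lemma moment_determinacy x : 0 < x -> \int[mu]_(y in `]0, x]) rho y = 0.
Proof.
move=> x0; pose b := ln 2 / x.
have b0 : 0 < b by rewrite divr_gt0// ln_gt0// ltr1n.
pose K m y := rho y * (1 - expR (- b * y) ^+ m) ^+ (2 ^ m).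
have Kint m : expdecay (K m) /\ \Int (K m) = 0.
  have [h1 h2] := @kernel0 (m%:R * b) (2 ^ m) 0 (mulr_ge0 (ler0n _ _) (ltW b0)) (lexx _).
  have e y : rho y * expR (- 0 * y) * (1 - expR (- (m%:R * b) * y)) ^+ (2 ^ m) = K m y.
    rewrite oppr0 mul0r expR0 mulr1 /K; congr (_ * (1 - _) ^+ _).
    by rewrite -expRM_natl; congr expR; ring.
  split; first by apply: eq_expdecay h1 => y _; rewrite e.
  by apply: etrans h2; apply: eq_Rintegral => y _; rewrite e.
have [C C0 hC] := expbnd_ge0 brho.
have Kle m y : 0 < y -> `|K m y| <= C * expR (- (1 / 4) * y).
  move=> y0; rewrite /K normrM -[leRHS]mulr1 ler_pM// ?hC//.
  have : 0 <= expR (- b * y) ^+ m <= 1.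
    rewrite exprn_ge0 ?expR_ge0//= exprn_ile1 ?expR_ge0// expR_le1 mulNr oppr_le0.
    by rewrite mulr_ge0 ?ltW.
  move=> /andP[h0 h1]; rewrite ger0_norm ?exprn_ge0 ?subr_ge0//.
  by rewrite exprn_ile1 ?subr_ge0// lerBlDr lerDl.
(* The threshold w = 1/2 of the kernels is attained at y = x. *)
have half : expR (- b * x) = 1 / 2.
  by rewrite /b mulNr divfK ?gt_eqF// expRN lnK ?posrE// mul1r.
have e14 : 0 < 1 / 4 :> R by lra.
have erho : expdecay rho by split => //; exists (1 / 4).
have sx : `]x, +oo[ `<=` Rpos by exact/sub_itv_oo_Rpos/ltW.
have s0 : `]0, x[ `<=` Rpos by move=> y /=; rewrite !in_itv/= andbT => /andP[].
have tail : \int[mu]_(y in `]x, +oo[) K m y @[m --> \oo] --> \int[mu]_(y in `]x, +oo[) rho y.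
  apply: (@Rintegral_dominated_cvg R _ (1 / 4) C) => //.
  - by move=> m; apply: measurable_funS sx _ => //; have [[]] := Kint m.
  - move=> y; rewrite /= in_itv/= andbT => xy; rewrite -[X in _ --> X]mulr1.
    apply: cvgMr; apply: kernel_cvg1; first exact: expR_ge0.
    by rewrite -half ltr_expR !mulNr ltrN2 ltr_pM2l.
  - by move=> m y /sx; rewrite /= in_itv/= andbT => /Kle.
have head : \int[mu]_(y in `]0, x[) K m y @[m --> \oo] --> \int[mu]_(y in `]0, x[) cst 0 y.
  apply: (@Rintegral_dominated_cvg R _ (1 / 4) C) => //.
  - by move=> m; apply: measurable_funS s0 _ => //; have [[]] := Kint m.
  - move=> y; rewrite /= in_itv/= => /andP[y0 yx]; rewrite -[X in _ --> X](mulr0 (rho y)).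
    apply: cvgMr; apply: kernel_cvg0.
      by rewrite -half ltr_expR !mulNr ltrN2 ltr_pM2l.
    by rewrite expR_le1 mulNr oppr_le0 mulr_ge0// ltW.
  - by move=> m y /s0; rewrite /= in_itv/= andbT => /Kle.
have tail0 : \int[mu]_(y in `]x, +oo[) rho y = 0.
  have h : (\int[mu]_(y in `]0, x[) K m y + \int[mu]_(y in `]x, +oo[) K m y
      @[m --> \oo] --> 0 + \int[mu]_(y in `]x, +oo[) rho y)%R.
    apply: cvgD => //; apply: cvg_trans head _.
    by rewrite Rintegral_cst// mul0r.
  have hK m : \int[mu]_(y in `]0, x[) K m y + \int[mu]_(y in `]x, +oo[) K m y = 0.
    have [eK iK] := Kint m.
    have iK0 : mu.-integrable `]0, x[ (EFin \o K m) by apply: expdecay_integrableS => //.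
    rewrite Rintegral_itv_bndo_bndc//; exact: etrans (esym (Rpos_split x0 eK)) iK.
  move: h; under eq_fun do rewrite hK.
  by move=> /(cvg_lim (@Rhausdorff R)); rewrite lim_cst// add0r => <-.
have := Rpos_split x0 erho; rewrite tail0 addr0 => <-.
apply: etrans (rho_moment 1); apply: eq_Rintegral => y _.
by rewrite hornerE mulr1.
Qed.

End MomentDeterminacy.

(** * The integrated Laguerre expansion *)

(** Polynomials Q k of degree exactly k, for k < m, span the polynomials of degree less
than m.  This is used for the Laguerre polynomials and for the P_k. *)
Lemma poly_span_ind (F : fieldType) (Q : nat -> {poly F}) (T : {poly F} -> Prop) m :
  (forall k, size (Q k) = k.+1) -> T 0 ->
  (forall c p q, T p -> T q -> T (c *: p + q)) ->
  (forall k, (k < m)%N -> T (Q k)) ->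
  forall p : {poly F}, (size p <= m)%N -> T p.
Proof.
move=> sQ T0 Tlin; elim: m => [|m ih] TQ p.
  by rewrite leqn0 size_poly_eq0 => /eqP ->.
move=> pm; pose c := p`_m / lead_coef (Q m).
have lQ : lead_coef (Q m) != 0 by rewrite lead_coef_eq0 -size_poly_eq0 sQ.
rewrite -(subrKC (c *: Q m) p); apply: Tlin; first exact: TQ.
apply: ih => [k km|]; first by apply: TQ; exact: ltnW.
apply/leq_sizeP => j mj; rewrite coefB coefZ.
have [->|jm] := eqVneq j m.
  by move: lQ; rewrite /c lead_coefE sQ/= => lQ; rewrite divfK ?subrr.
rewrite !nth_default ?mulr0 ?subrr//.
  by rewrite sQ ltn_neqAle eq_sym jm.
by rewrite (leq_trans pm)// ltn_neqAle eq_sym jm.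
Qed.

Section Expansion.
Context {R : realType}.
Implicit Types (a b c d x y : R) (psi G g : R -> R) (k m n i j : nat) (p q : {poly R}).

Local Notation mu := (@lebesgue_measure R).
Local Notation Rpos := (`]0, +oo[%classic : set R).
Local Notation "'\Int' phi" := (\int[mu]_(x in Rpos) phi x) (at level 10).

Lemma size_laguerre_poly k a : size (laguerre_poly k a) = k.+1.
Proof.
have [h1 h2] := rodrigues_poly_coef k a.
have f0 : k`!%:R^-1 != 0 :> R by rewrite invr_eq0 pnatr_eq0 -lt0n fact_gt0.
rewrite /laguerre_poly size_scale//; apply/eqP; rewrite eqn_leq; apply/andP; split.
  by apply/leq_sizeP => j kj; exact: h1.
rewrite ltnNge; apply/negP => /leq_sizeP/(_ k (leqnn _)) => h.
by move: h2; rewrite h => /esym/eqP; rewrite signr_eq0.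
Qed.

Lemma lagf_dual k j a : 0 <= a ->
  \Int (fun x => lagf k a x * (laguerre_poly j a).[x]) = if k == j then sqnorm_lag k a else 0.
Proof.
move=> a0; have [<-|kj] := eqVneq k j.
  by apply: eq_Rintegral => x _; rewrite mulrC.
have [lt|gt|e] := ltngtP j k; last by rewrite e eqxx in kj.
  rewrite -[RHS](@lagf_orthogonal _ k a (laguerre_poly j a) a0) ?size_laguerre_poly//.
  by apply: eq_Rintegral => x _; rewrite mulrC.
rewrite -[RHS](@lagf_orthogonal _ j a (laguerre_poly k a) a0) ?size_laguerre_poly//.
by apply: eq_Rintegral => x _; rewrite /lagf; ring.
Qed.

Section expansion.
Variables (a : R) (phi : nat -> R -> R).
Hypotheses (a0 : 0 <= a) (tphi : tame phi).

Let a1 : 0 <= a + 1. Proof. by rewrite addr_ge0. Qed.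

(** The coefficients decay faster than any power, so they absorb the polynomial growth of
lagf_bound and leave an inverse square.  The index l may be smaller than k and the
parameter b is free because the iterated primitives lower the index and raise the
parameter of the Laguerre function, but keep the coefficient. *)
Lemma lcoef_lagf_bound (b : R) : 0 <= b -> exists2 C, 0 <= C &
  forall l k x, (l <= k)%N -> 0 < x ->
    `|lcoef phi (a + 1) k * lagf l (b + 1) x| <=
      C * (k.+1%:R ^+ 2)^-1 * expR (- (1 / 4) * x).
Proof.
move=> b0; have [A [C C0 hC]] := lagf_bound b0.
have [C' C'0 hC'] := lcoef_decay (A + 2) a1 tphi.
exists (C * C') => [|l k x lk x0]; first exact: mulr_ge0.
have kA m : 0 < k.+1%:R ^+ m :> R by rewrite exprn_gt0.
rewrite normrM.
apply: (@le_trans _ _ ((C' / k.+1%:R ^+ (A + 2)) * (C * k.+1%:R ^+ A * expR (- (1 / 4) * x)))).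
  apply: ler_pM => //; first by rewrite ler_pdivlMr.
  apply: le_trans (hC _ _ x0) _; rewrite ler_pM2r ?expR_gt0// ler_wpM2l//.
  by rewrite lerXn2r ?nnegrE// ler_nat.
rewrite le_eqVlt; apply/orP; left; apply/eqP.
by rewrite exprD; field; rewrite nat1r pnatr_eq0 (gt_eqF (kA A)).
Qed.

Let v k x := lcoef phi (a + 1) k * lagf k (a + 1) x.

Let v_bound : exists2 B : nat -> R, cvgn (series B) &
  forall k x, 0 < x -> `|v k x| <= B k * expR (- (1 / 4) * x).
Proof.
have [C C0 hC] := lcoef_lagf_bound a0.
exists (C *: (fun k => (k.+1%:R ^+ 2)^-1) : nat -> R).
  by apply: is_cvg_seriesZ; exact: cvg_series_invr_sqr.
by move=> k x x0; exact: hC.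
Qed.

Let v_measurable k : measurable_fun Rpos (v k).
Proof. by apply: measurable_funM => //; exact: lagf_measurable. Qed.

Let g x := limn (series (v ^~ x)).

Let g_expdecay : expdecay g.
Proof.
have [B cB hB] := v_bound.
by apply: (@dominated_series_expdecay _ (1 / 4) B) => //; lra.
Qed.

Let fW x := phi 0%N x * gweight (a + 1) x.

Let fW_bound : expbnd (- (1 / 4)) fW.
Proof.
have -> : - (1 / 4) = 1 / 4 + - (1 / 2) :> R by lra.
by apply: expbndM; [exact: tphi.2|apply: gweight_expbnd => //; lra].
Qed.

Let fW_measurable : measurable_fun Rpos fW.
Proof.
apply: measurable_funM; first exact: tame_measurable.
by have [] := gweight_expdecay a1.
Qed.

Let rho x := fW x + -1 * g x.

Let rho_bound : expbnd (- (1 / 4)) rho.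
Proof.
apply: expbndD => //; apply: expbndZ.
have [B cB hB] := v_bound; exists (limn (series B)) => x x0.
by apply: dominated_series_le => //; lra.
Qed.

Let rho_measurable : measurable_fun Rpos rho.
Proof.
by apply: measurable_funD => //; apply: measurable_funM => //; have [] := g_expdecay.
Qed.

Let expdecay_mul_poly (h : R -> R) p : measurable_fun Rpos h -> expbnd (- (1 / 4)) h ->
  expdecay (fun x => h x * p.[x]).
Proof.
move=> mh bh; apply: (@expdecayM _ (- (1 / 4)) (1 / 8)) => //; first by lra.
  apply: Rpos_continuous_measurable => x _; exact: continuous_horner.
by apply: expbnd_poly; lra.
Qed.

Let g_bound : expbnd (- (1 / 4)) g.
Proof.
have [B cB hB] := v_bound; exists (limn (series B)) => x x0.
by apply: dominated_series_le => //; lra.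
Qed.

(** Only the term k = j of the series survives. *)
Let g_laguerre j : \Int (fun x => g x * (laguerre_poly j (a + 1)).[x]) =
  lcoef phi (a + 1) j * sqnorm_lag j (a + 1).
Proof.
have [B cB hB] := v_bound.
have h : series (fun k => \Int (fun x => v k x * (laguerre_poly j (a + 1)).[x])) @ \oo -->
    \Int (fun x => g x * (laguerre_poly j (a + 1)).[x]).
  apply: (@dominated_series_Rintegral _ (1 / 4) B v v_measurable hB cB _ _ (1 / 8)) => //.
  - by lra.
  - by apply: Rpos_continuous_measurable => x _; exact: continuous_horner.
  - by apply: expbnd_poly; lra.
have e k : \Int (fun x => v k x * (laguerre_poly j (a + 1)).[x]) =
    if k == j then lcoef phi (a + 1) j * sqnorm_lag j (a + 1) else 0.
  rewrite (@eq_Rintegral _ _ _ mu _ (fun x => lcoef phi (a + 1) k *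
    (lagf k (a + 1) x * (laguerre_poly j (a + 1)).[x]))); last first.
    by move=> x _ /=; rewrite /v -mulrA.
  rewrite RintegralZl//; last first.
    apply/expdecay_integrable/expdecay_mul_poly; first exact: lagf_measurable.
    by apply: lagf_expbnd => //; lra.
  by rewrite lagf_dual//; case: eqP => [->//|_]; rewrite mulr0.
have e2 N : series (fun k => \Int (fun x => v k x * (laguerre_poly j (a + 1)).[x])) (N + j.+1)%N
   = lcoef phi (a + 1) j * sqnorm_lag j (a + 1).
  have jN : (j < N + j.+1)%N by rewrite addnS ltnS leq_addl.
  rewrite seriesEord/= (bigD1 (Ordinal jN))//= e eqxx big1 ?addr0// => i.
  by rewrite -val_eqE/= => /negPf ij; rewrite e ij.
move: h; rewrite -(cvg_shiftn j.+1); under eq_fun do rewrite e2.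
by move=> /(cvg_lim (@Rhausdorff R)); rewrite lim_cst.
Qed.

Let rho_laguerre j : \Int (fun x => rho x * (laguerre_poly j (a + 1)).[x]) = 0.
Proof.
have e1 : expdecay (fun x => fW x * (laguerre_poly j (a + 1)).[x]) by exact: expdecay_mul_poly.
have e2 : expdecay (fun x => g x * (laguerre_poly j (a + 1)).[x]).
  by apply: expdecay_mul_poly => //; have [] := g_expdecay.
rewrite (@eq_Rintegral _ _ _ mu _ (fun x => fW x * (laguerre_poly j (a + 1)).[x] +
  -1 * (g x * (laguerre_poly j (a + 1)).[x]))); last first.
  by move=> x _; rewrite /rho mulrDl mulrA.
rewrite RintegralD//; [|exact: expdecay_integrable|exact/expdecay_integrable/expdecayZ].
rewrite RintegralZl ?g_laguerre//; last exact: expdecay_integrable.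
rewrite /lcoef divfK ?gt_eqF ?sqnorm_lag_gt0// mulN1r; apply/eqP; rewrite subr_eq0; apply/eqP.
by apply: eq_Rintegral => x _; rewrite /fW /lagf mulrA.
Qed.

Let rho_poly p : \Int (fun x => rho x * p.[x]) = 0.
Proof.
apply: (@poly_span_ind _ (fun k => laguerre_poly k (a + 1))
  (fun p => \Int (fun x => rho x * p.[x]) = 0) (size p)) => //.
- by move=> k; exact: size_laguerre_poly.
- rewrite (@eq_Rintegral _ _ _ mu _ (cst 0)) ?Rintegral_cst ?mul0r// => x _.
  by rewrite horner0 mulr0.
- move=> c q r hq hr; have eq := expdecay_mul_poly q rho_measurable rho_bound.
  have er := expdecay_mul_poly r rho_measurable rho_bound.
  rewrite (@eq_Rintegral _ _ _ mu _ (fun x => c * (rho x * q.[x]) + rho x * r.[x])); last first.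
    by move=> x _; rewrite hornerD hornerZ; ring.
  rewrite RintegralD//; [|exact/expdecay_integrable/expdecayZ|exact: expdecay_integrable].
  by rewrite RintegralZl ?hq ?hr ?mulr0 ?addr0//; exact: expdecay_integrable.
Qed.

(** The difference rho between the weighted function and the sum of its weighted Laguerre
series has zero moments, hence zero integral over ]0, x]. *)
Lemma laguerre_expansion_integral x : 0 < x ->
  series (fun k => lcoef phi (a + 1) k * \int[mu]_(y in `]0, x]) lagf k (a + 1) y) @ \oo -->
  \int[mu]_(y in `]0, x]) (phi 0%N y * gweight (a + 1) y).
Proof.
move=> x0; have := moment_determinacy rho_measurable rho_bound rho_poly x0.
have efW : expdecay fW by split => //; exists (1 / 4) => //; lra.
have iE (h : R -> R) : expdecay h -> mu.-integrable `]0, x] (EFin \o h).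
  by move=> eh; apply: expdecay_integrableS => //; exact: sub_itv_oc_Rpos.
rewrite RintegralD//; [|exact: iE|exact/iE/expdecayZ].
rewrite RintegralZl//; last exact: iE.
rewrite mulN1r => /eqP; rewrite subr_eq0 => /eqP ->.
have [B cB hB] := v_bound.
have : series (fun k => \int[mu]_(y in `]0, x]) (v k y * 1)) @ \oo -->
    \int[mu]_(y in `]0, x]) (g y * 1).
  apply: (@dominated_series_Rintegral _ (1 / 4) B v v_measurable hB cB _ (cst 1) 0) => //.
  - exact: sub_itv_oc_Rpos.
  - exact: expbnd_cst.
under [X in _ --> X -> _]eq_Rintegral => y _ do rewrite mulr1.
rewrite (_ : (fun k => \int[mu]_(y in `]0, x]) (v k y * 1)) =
  (fun k => lcoef phi (a + 1) k * \int[mu]_(y in `]0, x]) lagf k (a + 1) y))//.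
apply/funext => k; rewrite -RintegralZl//.
  by apply: eq_Rintegral => y _; rewrite mulr1.
apply: iE; apply: (@expdecay_continuous _ (1 / 4)); first by lra.
  by move=> y; exact: lagf_continuous.
by apply: lagf_expbnd => //; lra.
Qed.

End expansion.
End Expansion.

(** * The functions e^{-t/x} p(x) and their Laguerre coefficients *)

Section Flat.
Context {R : realType}.
Implicit Types (a b c d x y : R) (psi G g : R -> R) (k m n i j : nat) (p q : {poly R}).

Local Notation mu := (@lebesgue_measure R).
Local Notation Rpos := (`]0, +oo[%classic : set R).
Local Notation "'\Int' phi" := (\int[mu]_(x in Rpos) phi x) (at level 10).

(** The Borel sigma-algebra of R carries two structures that differ by their display only,
and the integral in the definition of orthonormality is taken over the other one.
Integrals are transferred as integrals of a pushforward by the identity. *)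
Lemma integral_borel_display (E : set R) (f : R -> R) :
  let mu0 : set R -> \bar R := @lebesgue_measure R in
  measurable E -> measurable_fun E f ->
  (\int[mu0]_(x in E) (f x)%:E = \int[mu]_(x in E) (f x)%:E)%E.
Proof.
move=> mu0 mE mf; pose T := Real_sort__canonical__measurable_structure_Measurable R.
have mid : measurable_fun setT (id : measurableTypeR R -> T).
  by move=> _ B mB; rewrite setTI.
have mf' : measurable_fun E (EFin \o f) by exact/measurable_EFinP.
have key (g : R -> \bar R) : measurable_fun E g -> (forall y, 0 <= g y)%E ->
    (\int[mu0]_(x in E) g x = \int[mu]_(x in E) g x)%E.
  move=> mg g0.
  exact (ge0_integral_pushforward mid mu mE mg (fun y _ => g0 y)).
pose nu : {measure set T -> \bar R} :=
  pushforward (@lebesgue_measure R) (id : measurableTypeR R -> T).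
apply: etrans (@integralE _ _ R (nu mid) E (EFin \o f)) _.
rewrite [RHS]integralE; congr (_ - _)%E; apply: key => //.
  exact: measurable_funepos.
exact: measurable_funeneg.
Qed.

Section flat.
Variables (t : R) (p : {poly R}).
Hypothesis t0 : 0 < t.

(** The polynomial numerators in the successive derivatives of e^{-t/x} p(x), the
denominator of the i-th one being x^{2i}. *)
Fixpoint flat_poly i : {poly R} :=
  if i is i'.+1 then
    t *: flat_poly i' - (i'.*2)%:R *: ('X * flat_poly i') + 'X^2 * (flat_poly i')^`()
  else p.

Definition flat i x := expR (- t / x) * x^-1 ^+ i.*2 * (flat_poly i).[x].

Lemma is_derive_invX j x : 0 < x ->
  is_derive x 1 (fun y => y^-1 ^+ j) (- j%:R * x^-1 ^+ j.+1).
Proof.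
move=> x0; elim: j => [|j ih].
  by under eq_fun do rewrite expr0; rewrite oppr0 mul0r; exact: is_derive_cst.
have dV : is_derive x 1 (fun y => y^-1) (- x^-1 ^+ 2).
  have := @is_deriveV _ id x 1 1 _ (is_derive_id x 1).
  move=> h; apply: is_derive_eq (h _) _; first by rewrite gt_eqF.
  by rewrite /GRing.scale/= mulr1 exprVn.
under eq_fun do rewrite exprS.
apply: is_derive_eq (is_derive_fM dV ih) _.
by rewrite -natr1 !exprS expr0; ring.
Qed.

Lemma is_derive_expRV x : 0 < x ->
  is_derive x 1 (fun y => expR (- t / y)) (expR (- t / x) * (t * x^-1 ^+ 2)).
Proof.
move=> x0.
have h1 : is_derive x 1 (fun y => - t / y) (t * x^-1 ^+ 2).
  have := is_derive_invX 1 x0; under eq_fun do rewrite expr1.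
  move=> h; apply: is_derive_eq (@is_deriveZ _ _ _ _ (- t) _ _ _ h) _.
  by rewrite /GRing.scale/= mulN1r mulrNN.
by have := @is_derive1_comp _ expR _ x _ _ (is_derive_expR (- t / x)) h1.
Qed.

(** The factor e^{-t/x} compensates the pole x^{-2i} at 0, since (t/x)^j <= j! e^{t/x}. *)
Lemma tame_flat : tame flat.
Proof.
split=> [i x x0|i].
  have h := is_derive_fM (is_derive_fM (is_derive_expRV x0) (is_derive_invX i.*2 x0))
    (is_derive_poly (flat_poly i) x).
  apply: is_derive_eq h _; rewrite /flat doubleS /=.
  rewrite !(hornerD, hornerN, hornerZ, hornerM, hornerX, hornerXn) !exprS expr0.
  by field; rewrite gt_eqF.
have -> : 1 / 4 = 0 + 1 / 4 :> R by lra.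
apply: expbndM; last by apply: expbnd_poly.
exists ((i.*2)`!%:R / t ^+ i.*2) => x x0; rewrite mul0r expR0 mulr1.
have tx : 0 <= t / x by rewrite divr_ge0// ltW.
rewrite ger0_norm ?mulr_ge0 ?expR_ge0 ?exprn_ge0 ?invr_ge0 ?(ltW x0)//.
rewrite ler_pdivlMr ?exprn_gt0// -mulrA -exprMn mulNr expRN mulrC.
by rewrite ler_pdivrMr ?expR_gt0// (mulrC _ t) exprn_le_expR.
Qed.

Lemma flat0 x : flat 0 x = expR (- t / x) * p.[x].
Proof. by rewrite /flat mulr1. Qed.

End flat.

Lemma laguerre_coefE nu t p k : 0 <= nu ->
  laguerre_coef nu t p k = lcoef (flat t p) nu k.
Proof.
move=> nu0; rewrite /laguerre_coef /lcoef sqnorm_lagE// gmass_Gamma invf_div.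
rewrite (addrC k%:R) mulrC; congr (_ * _); apply: eq_Rintegral => x.
rewrite inE/= in_itv/= andbT => x0; rewrite laguerreE// flat0 /lagf /gweight.
by rewrite expRD mulNr; ring.
Qed.

Section vanishing.
Variables (nu t : R) (P : nat -> {poly R}).
Hypotheses (nu0 : 0 <= nu) (t0 : 0 < t) (hP : orthonormal_polys nu t P).

(** The weight e^{-x-t/x} x^nu for which the P_j are orthonormal is the Laguerre weight
times the factor e^{-t/x} of the function, so P n is orthogonal to the span of the
P j with j < n, which contains the Laguerre polynomial of degree k. *)
Lemma lcoef_orthonormal n k : (k < n)%N -> lcoef (flat t (P n)) nu k = 0.
Proof.
move=> kn; have [sP _ oP] := hP; rewrite /lcoef.
suff -> : \Int (fun x => flat t (P n) 0 x * lagf k nu x) = 0 by rewrite mul0r.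
have tf := tame_flat (P n) t0.
have eq q : expdecay (fun x => flat t (P n) 0 x * (gweight nu x * q.[x])).
  apply: (@expdecayM _ (1/4) (- (1/2))); first by lra.
  - exact: tame_measurable.
  - apply: Rpos_continuous_measurable => x x0; apply: continuousM.
      exact: gweight_continuous.
    exact: continuous_horner.
  - exact: tf.2.
  - by apply: gweight_poly_expbnd => //; lra.
apply: (@poly_span_ind _ P
  (fun q => \Int (fun x => flat t (P n) 0 x * (gweight nu x * q.[x])) = 0) n) => //.
- rewrite (@eq_Rintegral _ _ _ mu _ (cst 0)) ?Rintegral_cst ?mul0r// => x _.
  by rewrite horner0 !mulr0.
- move=> c q r hq hr.
  rewrite (@eq_Rintegral _ _ _ mu _ (fun x =>
    c * (flat t (P n) 0 x * (gweight nu x * q.[x])) +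
    flat t (P n) 0 x * (gweight nu x * r.[x]))); last first.
    by move=> x _; rewrite hornerD hornerZ; ring.
  rewrite RintegralD//; [|exact/expdecay_integrable/expdecayZ|exact: expdecay_integrable].
  by rewrite RintegralZl ?hq ?hr ?mulr0 ?addr0//; exact: expdecay_integrable.
- move=> j jn.
  have e x : flat t (P n) 0 x * (gweight nu x * (P j).[x]) =
      (P n).[x] * (P j).[x] * expR (- x - t / x) * x `^ nu.
    by rewrite flat0 /gweight expRD mulNr; ring.
  have := oP n j; rewrite (gtn_eqF jn) integral_borel_display//; last first.
    by apply: (eq_measurable_fun _ _ (eq (P j)).1) => x _; rewrite e.
  by under eq_integral => x _ do rewrite -e; rewrite /Rintegral => ->.
- by rewrite size_laguerre_poly.
Qed.

End vanishing.

Lemma lagf_primitive k a x : 0 <= a -> 0 < x ->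
  \int[mu]_(y in `]0, x]) lagf k.+1 a y = k.+1%:R^-1 * lagf k (a + 1) x.
Proof.
move=> a0 x0; have k1 : k.+1%:R != 0 :> R by rewrite pnatr_eq0.
have el : expdecay (lagf k.+1 a).
  apply: (@expdecay_continuous _ (1 / 2)); first by lra.
    by move=> y; exact: lagf_continuous.
  by apply: lagf_expbnd => //; lra.
have <- : \int[mu]_(y in `]0, x]) (k.+1%:R * lagf k.+1 a y) = lagf k (a + 1) x.
  apply: (@FTC_Rpos_head _ _ _ (1 / 2)) => //.
  - by move=> y; exact: is_derive_lagf.
  - move=> y y0; apply: continuousM; first exact: cst_continuous.
    exact: lagf_continuous.
  - by apply: lagf_div_expbnd => //; lra.
  - by apply/expbndZ/lagf_expbnd => //; lra.
by rewrite RintegralZl ?mulKf//; apply: expdecay_integrableS => //; exact: sub_itv_oc_Rpos.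
Qed.

(** The primitive formula is only assumed on the half-line, so G is compared with the
parametrised integral near x. *)
Lemma is_derive_primitive G g x : expdecay g -> 0 < x -> {for x, continuous g} ->
  (forall y, 0 < y -> G y = \int[mu]_(z in `]0, y]) g z) -> is_derive x 1 G (g x).
Proof.
move=> eg x0 cg GE.
have xx : x < x + 1 by rewrite ltrDl.
have ig : mu.-integrable `]0, x + 1] (EFin \o g).
  by apply: expdecay_integrableS => //; exact: sub_itv_oc_Rpos.
have [d1 d2] := @continuous_FTC1 R g (BRight 0) x (x + 1) xx ig x0 cg.
apply: (@near_eq_is_derive _ _ _ (fun y => \int[mu]_(z in `]0, y]) g z)).
  by near=> y; rewrite GE//; near: y; exact: near_Rpos.
by apply: DeriveDef => //; rewrite -derive1E.
Unshelve. all: by end_near. Qed.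

End Flat.

(** * Iterated primitives of the Laguerre series *)

Section Rodrigues.
Context {R : realType}.
Implicit Types (b c d x y : R) (psi G g : R -> R) (k m i j : nat).

Local Notation mu := (@lebesgue_measure R).
Local Notation Rpos := (`]0, +oo[%classic : set R).
Local Notation "'\Int' phi" := (\int[mu]_(x in Rpos) phi x) (at level 10).

Variables (a : R) (phi : nat -> R -> R) (n : nat).
Hypotheses (a0 : 0 <= a) (tphi : tame phi) (n0 : (0 < n)%N).
Hypothesis vanish : forall k, (k < n)%N -> lcoef phi (a + 1) k = 0.

Let a1 : 0 <= a + 1. Proof. by rewrite addr_ge0. Qed.

(** For m + j = n this is the term of the j-fold primitive, from 0, of the Laguerre
series multiplied by w_{a+1}: each primitive lowers the index of the Laguerre
function, raises its parameter and divides by the former index.  The first n terms of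
the original series vanish, which explains the shift of k by n. *)
Definition rodrigues_term m j k x :=
  lcoef phi (a + 1) (k + n) * ((k + m)`!%:R / (k + n)`!%:R) *
  lagf (k + m) (a + 1 + j%:R) x.

Definition rodrigues_sum m j x := limn (series (fun k => rodrigues_term m j k x)).

Let term_bound m j : (m <= n)%N -> exists2 B : nat -> R, cvgn (series B) &
  forall k x, 0 < x -> `|rodrigues_term m j k x| <= B k * expR (- (1 / 4) * x).
Proof.
move=> mn; have aj : 0 <= a + j%:R by rewrite addr_ge0.
have [C C0 hC] := lcoef_lagf_bound a0 tphi aj.
exists (C *: (fun k => (k.+1%:R ^+ 2)^-1) : nat -> R).
  by apply: is_cvg_seriesZ; exact: cvg_series_invr_sqr.
move=> k x x0; rewrite /rodrigues_term addrAC mulrAC mulrC.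
rewrite normrM; apply: (@le_trans _ _ (1 * (C * ((k + n).+1%:R ^+ 2)^-1 * expR (- (1 / 4) * x)))).
  apply: ler_pM => //; last by apply: hC => //; rewrite leq_add2l.
  rewrite ger0_norm ?divr_ge0// ler_pdivrMr ?ltr0n ?fact_gt0// mul1r ler_nat.
  by rewrite leq_fact// leq_add2l.
rewrite mul1r ler_wpM2r ?expR_ge0// /GRing.scale/= ler_wpM2l//.
rewrite lef_pV2 ?posrE ?exprn_gt0//.
by rewrite lerXn2r ?nnegrE// ler_nat ltnS leq_addr.
Qed.

Let term_expdecay m j k : expdecay (rodrigues_term m j k).
Proof.
apply: expdecayZ; apply: (@expdecay_continuous _ (1 / 4)); first by lra.
  by move=> x; exact: lagf_continuous.
by apply: lagf_expbnd; [rewrite addr_ge0|lra].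
Qed.

Lemma rodrigues_sum_cvg m j x : (m <= n)%N -> 0 < x ->
  cvgn (series (fun k => rodrigues_term m j k x)).
Proof.
by move=> mn x0; have [B cB hB] := term_bound j mn; exact: (dominated_series_cvg hB cB).
Qed.

Let sum_expdecay m j : (m <= n)%N -> expdecay (rodrigues_sum m j).
Proof.
move=> mn; have [B cB hB] := term_bound j mn.
apply: (@dominated_series_expdecay _ (1 / 4) B) => //.
by move=> k; have [] := term_expdecay m j k.
Qed.

Lemma rodrigues_sum_primitive m j x : (m < n)%N -> 0 < x ->
  \int[mu]_(y in `]0, x]) rodrigues_sum m.+1 j y = rodrigues_sum m j.+1 x.
Proof.
move=> mn x0; have [B cB hB] := term_bound j mn.
have mt k : measurable_fun Rpos (rodrigues_term m.+1 j k).
  by have [] := term_expdecay m.+1 j k.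
have := @dominated_series_Rintegral _ (1 / 4) B (rodrigues_term m.+1 j) mt hB cB
  `]0, x] (cst 1) 0.
move=> /(_ _ _ _ _ _) h.
have {}h : series (fun k => \int[mu]_(y in `]0, x]) (rodrigues_term m.+1 j k y * 1)) @ \oo -->
  \int[mu]_(y in `]0, x]) (rodrigues_sum m.+1 j y * 1).
  by apply: h => //; [exact: sub_itv_oc_Rpos|exact: expbnd_cst].
move: h; under [X in _ --> X -> _]eq_Rintegral => y _ do rewrite mulr1.
move=> /(cvg_lim (@Rhausdorff R)) <-; congr (limn (series _)); apply/funext => k.
transitivity (\int[mu]_(y in `]0, x]) (lcoef phi (a + 1) (k + n) *
  ((k + m.+1)`!%:R / (k + n)`!%:R) * lagf (k + m.+1) (a + 1 + j%:R) y)).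
  by apply: eq_Rintegral => y _; rewrite mulr1.
have aj : 0 <= a + 1 + j%:R by rewrite addr_ge0.
rewrite RintegralZl//; last first.
  apply: expdecay_integrableS => //; first exact: sub_itv_oc_Rpos.
  apply: (@expdecay_continuous _ (1 / 4)); first by lra.
    by move=> y; exact: lagf_continuous.
  by apply: lagf_expbnd => //; lra.
rewrite addnS lagf_primitive// /rodrigues_term factS natrM -(addrA (a + 1)) natr1.
have k1 : (k + m).+1%:R != 0 :> R by rewrite pnatr_eq0.
have f0 : (k + n)`!%:R != 0 :> R by rewrite pnatr_eq0 -lt0n fact_gt0.
by move: (k + m).+1%:R k1 => s s0; field; rewrite f0 s0.
Qed.

(** The first primitive is the integrated Laguerre expansion without its first n terms,
which are zero. *)
Lemma rodrigues_sum_expansion x : 0 < x ->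
  \int[mu]_(y in `]0, x]) (phi 0%N y * gweight (a + 1) y) = rodrigues_sum n.-1 1 x.
Proof.
move=> x0; have := laguerre_expansion_integral a0 tphi x0.
set u := (X in series X @ _ --> _); rewrite -(cvg_shiftn n).
have e N : series u (N + n)%N = series (fun k => rodrigues_term n.-1 1 k x) N.
  elim: N => [|N ih].
    rewrite add0n !seriesEnat/= [RHS]big_geq// big_nat big1// => i /andP[_ ni].
    by rewrite /u vanish// mul0r.
  rewrite addSn !seriesSr ih; congr (_ + _); rewrite /u /rodrigues_term.
  rewrite -(prednK n0) addnS lagf_primitive// mulrA; congr (_ * _ * _).
  rewrite factS natrM invfM mulrCA divff ?mulr1//.
under eq_fun do rewrite e.
by move=> /(cvg_lim (@Rhausdorff R)) <-.
Qed.

(** The j-fold primitive of phi 0 times w_{a+1}.  For j = 0 it is that function itself,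
so the n-th derivative of the n-th member is exactly phi 0 times w_{a+1}. *)
Definition rodrigues_chain j x :=
  if j is j'.+1 then rodrigues_sum (n - j) j x else phi 0%N x * gweight (a + 1) x.

Lemma rodrigues_chainE j x : (0 < j)%N ->
  rodrigues_chain j x = rodrigues_sum (n - j) j x.
Proof. by case: j. Qed.

Let chain_expdecay j : expdecay (rodrigues_chain j).
Proof.
case: j => [|j]; last by apply: sum_expdecay; exact: leq_subr.
apply: (eq_expdecay (phi := fun x => phi 0%N x * lagf 0 (a + 1) x)).
  by move=> x _; rewrite lagf0.
exact: expdecay_tame_lagf.
Qed.

Let chain_primitive j x : (j < n)%N -> 0 < x ->
  rodrigues_chain j.+1 x = \int[mu]_(y in `]0, x]) rodrigues_chain j y.
Proof.
case: j => [|j] jn x0; first by rewrite /= rodrigues_sum_expansion// subn1.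
rewrite /= -rodrigues_sum_primitive//; last by rewrite ltn_subrL n0.
  by rewrite subnSK.
Qed.

(** Continuity of the integrand, required by the fundamental theorem of calculus, comes
from the differentiability obtained at the previous index. *)
Lemma is_derive_rodrigues_chain j x : (j < n)%N -> 0 < x ->
  is_derive x 1 (rodrigues_chain j.+1) (rodrigues_chain j x).
Proof.
elim: j x => [|j ih] x jn x0.
  apply: is_derive_primitive => //; last by move=> y; exact: chain_primitive.
  apply: continuousM; [exact: tame_continuous|exact: gweight_continuous].
apply: is_derive_primitive => //; last by move=> y; exact: chain_primitive.
exact: is_derive_continuous (ih x (ltnW jn) x0).
Qed.

Lemma derive1n_rodrigues_chain F i x :
  (forall y, 0 < y -> F y = rodrigues_chain n y) -> (i <= n)%N -> 0 < x ->
  derive1n i F x = rodrigues_chain (n - i) x.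
Proof.
move=> FE; elim: i x => [|i ih] x ni x0; first by rewrite derive1n0 subn0 FE.
rewrite derive1nS derive1E.
have nin : (n - i.+1 < n)%N by rewrite ltn_subrL n0.
have := is_derive_rodrigues_chain nin x0; rewrite subnSK// => -[_ <-].
apply: near_eq_derive; near=> y; apply: ih; first exact: ltnW.
by near: y; exact: near_Rpos.
Unshelve. all: by end_near. Qed.

Lemma derivable_rodrigues_chain F i x :
  (forall y, 0 < y -> F y = rodrigues_chain n y) -> (i < n)%N -> 0 < x ->
  derivable (derive1n i F) x 1.
Proof.
move=> FE ni x0; have nin : (n - i.+1 < n)%N by rewrite ltn_subrL n0.
have := is_derive_rodrigues_chain nin x0; rewrite subnSK// => -[h _].
apply: (@near_eq_derivable _ _ _ (rodrigues_chain (n - i))); last first.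
  exact: h.
near=> y; rewrite (derive1n_rodrigues_chain FE (ltnW ni))//.
by near: y; exact: near_Rpos.
Unshelve. all: by end_near. Qed.

End Rodrigues.

Unset Implicit Arguments.
Set Strict Implicit.
Set Printing Implicit Defensive.

Theorem mainTheorem6 (R : realType) (nu t : R) (P : nat -> {poly R}) (n : nat)
    (hnu : 3 / 2 < nu) (ht : 0 < t) (hn : (0 < n)%N)
    (hP : orthonormal_polys nu t P) :
  let u (x : R) (k : nat) : R :=
    laguerre_coef nu t (P n) (k + n) * k`!%:R / (k + n)`!%:R
    * laguerre k (n%:R + nu) x in
  let F (x : R) : R :=
    expR (- x) * x `^ (nu + n%:R) * limn (series (u x)) in
  forall x : R, 0 < x ->
    [/\ cvgn (series (u x)),
        forall j : nat, (j < n)%N -> derivable (derive1n j F) x 1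
      & (P n).[x] = x `^ (- nu) * expR (x + t / x) * derive1n n F x].
Proof.
move=> u F.
have nu0 : 0 <= nu by lra.
have a0 : 0 <= nu - 1 by lra.
have tphi := tame_flat (P n) ht; set phi := flat t (P n) in tphi.
have vanish k : (k < n)%N -> lcoef phi (nu - 1 + 1) k = 0.
  by rewrite subrK; exact: lcoef_orthonormal.
have termE x k : 0 < x ->
    rodrigues_term (nu - 1) phi n 0 n k x = gweight (nu + n%:R) x * u x k.
  move=> x0; rewrite /rodrigues_term /u laguerre_coefE// laguerreE// subrK addn0.
  by rewrite /lagf (addrC n%:R); ring.
have w0 x : 0 < x -> gweight (nu + n%:R) x != 0.
  by move=> x0; rewrite gt_eqF// gweight_gt0.
have uE x : 0 < x ->
    u x = (gweight (nu + n%:R) x)^-1 *: (fun k => rodrigues_term (nu - 1) phi n 0 n k x).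
  move=> x0; apply/funext => k.
  rewrite [RHS](_ : _ = (gweight (nu + n%:R) x)^-1 * (gweight (nu + n%:R) x * u x k)).
    by rewrite mulKf// w0.
  by rewrite -termE.
have cu x : 0 < x -> cvgn (series (u x)).
  move=> x0; rewrite uE//; apply: is_cvg_seriesZ.
  exact: (rodrigues_sum_cvg a0 tphi).
have FE y : 0 < y -> F y = rodrigues_chain (nu - 1) phi n n y.
  move=> y0; rewrite rodrigues_chainE// subnn /rodrigues_sum.
  have -> : (fun k => rodrigues_term (nu - 1) phi n 0 n k y) =
      gweight (nu + n%:R) y *: u y.
    by apply/funext => k; rewrite /GRing.scale/= termE.
  rewrite lim_seriesZ; last exact: cu.
  by rewrite /F /gweight /GRing.scale/=; congr (_ * _); exact: mulrC.
move=> x x0; split.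
- exact: cu.
- by move=> j jn; apply: (derivable_rodrigues_chain a0 tphi hn vanish FE jn x0).
- rewrite (derive1n_rodrigues_chain a0 tphi hn vanish FE (leqnn n) x0) subnn /=.
  rewrite subrK /phi flat0 /gweight expRD powRN mulNr !expRN.
  have p0 : x `^ nu != 0 by rewrite gt_eqF// powR_gt0.
  by field; rewrite p0 !expR_eq0.
Qed.
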